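(* Let $H_1,H_2,H_3$ be Hilbert $\mathfrak{A}$-modules, let $A\in\mathcal{L}(H_1,H_3)$ and $B\in\mathcal{L}(H_2,H_3)$, let $M\in\mathcal{L}(H_3)$ be positive definite, and let $$N=\begin{pmatrix} N_1 & L\\ L^* & N_2\end{pmatrix}\in\mathcal{L}(H_1\oplus H_2)$$ be positive definite, where $N_1\in\mathcal{L}(H_1)$, $L\in\mathcal{L}(H_2,H_1)$, $N_2\in\mathcal{L}(H_2)$. Suppose that $\mathcal{R}(A)$ is closed, put $C=(I_{H_3}-AA^\dag_{MN_1})B\in\mathcal{L}(H_2,H_3)$, and suppose that $\mathcal{R}(C)$ and $\mathcal{R}(A,C)$ are closed as well. Let $N_3\in\mathcal{L}(H_2)$ be an arbitrary positive definite operator. Define $$D=A^\dag_{MN_1}B\in\mathcal{L}(H_2,H_1),$$ $$\widetilde{S}=N_2-L^*(I_{H_1}-A^\dag_{MN_1}A)N_1^{-1}L+D^*N_1D-D^*L-L^*D\in\mathcal{L}(H_2),$$ $$R_{M;N_3,\widetilde{S}}=I_{H_2}+(I_{H_2}-C^\dag_{MN_3}C)N_3^{-1}(\widetilde{S}-N_3)\in\mathcal{L}(H_2),$$ $$V=R_{M;N_3,\widetilde{S}}^{-1}\Big(C^\dag_{MN_3}+(I_{H_2}-C^\dag_{MN_3}C)N_3^{-1}(D^*N_1-L^* )A^\dag_{MN_1}\Big)\in\mathcal{L}(H_3,H_2).$$ Then $$(A,B)^\dag_{MN}=\begin{pmatrix} A^\dag_{MN_1}-\big(D+(I_{H_1}-A^\dag_{MN_1}A)N_1^{-1}L\big)V\\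 V\end{pmatrix}.$$
   Context: $\mathfrak{A}$ is a $C^*$-algebra. For Hilbert $\mathfrak{A}$-modules $H,K$, $\mathcal{L}(H,K)$ is the set of adjointable operators from $H$ to $K$, $\mathcal{L}(H)=\mathcal{L}(H,H)$, $I_H$ is the identity, and $\mathcal{R}(T)$ denotes the range of $T$. $H_1\oplus H_2$ is the Hilbert $\mathfrak{A}$-module of column pairs with inner product $\langle \binom{x_1}{y_1},\binom{x_2}{y_2}\rangle=\langle x_1,x_2\rangle+\langle y_1,y_2\rangle$. $(A,B)\in\mathcal{L}(H_1\oplus H_2,H_3)$ denotes the operator $\binom{h_1}{h_2}\mapsto Ah_1+Bh_2$, similarly $(A,C)$. All adjoints $^*$ are with respect to the original inner products. An operator $M\in\mathcal{L}(K)$ is called positive definite if it is positive and invertible in $\mathcal{L}(K)$; since $N$ is positive definite, so is $N_1$. For $T\in\mathcal{L}(H,K)$ and positive definite $M\in\mathcal{L}(K)$, $N\in\mathcal{L}(H)$, the weighted Moore-Penrose inverse $T^\dag_{MN}$ is the (unique if it exists) $X\in\mathcal{L}(K,H)$ with $TXT=T$, $XTX=X$, $(MTX)^*=MTX$, $(NXT)^*=NXT$; it exists if and only if $\mathcal{R}(T)$ is closed. Under the hypotheses $\widetilde{S}$ is positive definite, $R_{M;N_3,\widetilde S}$ is invertible, and $\mathcal{R}(A,B)$ is closed, so that all expressions are well defined. *)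

(* Defs.v *)
From HB Require Import structures.
From mathcomp Require Import all_boot all_order all_algebra.
From mathcomp Require Import complex.
From mathcomp Require Import boolp classical_sets reals topology normedtype.

Set Implicit Arguments.
Unset Strict Implicit.
Unset Printing Implicit Defensive.

Import Order.TTheory GRing.Theory Num.Theory.
Import numFieldNormedType.Exports.

Local Open Scope ring_scope.
Local Open Scope classical_set_scope.

Reserved Notation "a ** b" (at level 40, left associativity).
Reserved Notation "x *< a" (at level 40, left associativity).
Reserved Notation "S \oL T" (at level 40, left associativity).

(* C*-algebras are not required to be unital, so the product is not the one of
   MathComp's rings. Norms of spaces over R[i] take values in R[i]. *)
HB.mixin Record isCStarAlgebra (R : realType) A
    of CompleteNormedModule R[i] A := {
  cmul : A -> A -> A;
  star : A -> A;
  cmulA : associative cmul;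
  cmulDl : left_distributive cmul +%R;
  cmulDr : right_distributive cmul +%R;
  cmulZl : forall (k : R[i]) (a b : A), cmul (k *: a) b = k *: cmul a b;
  cmulZr : forall (k : R[i]) (a b : A), cmul a (k *: b) = k *: cmul a b;
  starK : involutive star;
  starD : {morph star : a b / a + b};
  starZ : forall (k : R[i]) (a : A), star (k *: a) = k^* *: star a;
  starM : forall a b, star (cmul a b) = cmul (star b) (star a);
  cnormM : forall a b, `|cmul a b| <= `|a| * `|b|;
  cnorm_star : forall a, `|cmul (star a) a| = `|a| ^+ 2
}.

#[short(type="cstarAlgType")]
HB.structure Definition CStarAlgebra (R : realType) :=
  {A of isCStarAlgebra R A & CompleteNormedModule R[i] A}.

Notation "a ** b" := (cmul a b) : ring_scope.

(* Positive elements of a C*-algebra, as the elements b^* b. *)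
Definition cpositive (R : realType) (A : cstarAlgType R) (a : A) : Prop :=
  exists b : A, a = star b ** b.

(* Right A-modules with a nondegenerate hermitian A-valued form, linear in the
   second variable. This is the part of the structure of a Hilbert A-module on
   which adjointable operators and their adjoints depend; it is separated from
   positivity and completeness so that the direct sum below can be formed
   without first proving that it satisfies the latter two. *)
HB.mixin Record isHermitianModule (R : realType) (A : cstarAlgType R) H
    of GRing.Lmodule R[i] H := {
  ract : H -> A -> H;
  ip : H -> H -> A;
  ractDl : forall x y a, ract (x + y) a = ract x a + ract y a;
  ractDr : forall x a b, ract x (a + b) = ract x a + ract x b;
  ractM : forall x a b, ract x (a ** b) = ract (ract x a) b;
  ractZl : forall (k : R[i]) (x : H) a, ract (k *: x) a = k *: ract x a;
  ractZr : forall (k : R[i]) (x : H) a, ract x (k *: a) = k *: ract x a;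
  ipDr : forall x y z, ip x (y + z) = ip x y + ip x z;
  ipZr : forall (k : R[i]) (x y : H), ip x (k *: y) = k *: ip x y;
  ip_ract : forall x y a, ip x (ract y a) = ip x y ** a;
  ip_star : forall x y, star (ip x y) = ip y x;
  ip_nondeg : forall x, (forall y, ip x y = 0) -> x = 0
}.

#[short(type="hermModType")]
HB.structure Definition HermitianModule (R : realType) (A : cstarAlgType R) :=
  {H of isHermitianModule R A H & GRing.Lmodule R[i] H}.

Notation "x *< a" := (ract x a) : ring_scope.

(* Hilbert A-modules: the form is positive definite, and the module is complete
   for the norm |x| = |<x,x>|^(1/2). *)
HB.mixin Record isHilbertModule (R : realType) (A : cstarAlgType R) H
    of HermitianModule R A H & CompleteNormedModule R[i] H := {
  ip_pos : forall x : H, cpositive (ip x x : A);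
  ip_def : forall x : H, (ip x x : A) = 0 -> x = 0;
  norm_ip : forall x : H, `|x| ^+ 2 = `|(ip x x : A)|
}.

#[short(type="hilbertModType")]
HB.structure Definition HilbertModule (R : realType) (A : cstarAlgType R) :=
  {H of isHilbertModule R A H & HermitianModule R A H
      & CompleteNormedModule R[i] H}.

Section HermitianModuleTheory.
Context {R : realType} {A : cstarAlgType R}.

Lemma star0 : star (0 : A) = 0.
Proof. by apply: (addrI (star 0)); rewrite -starD !addr0. Qed.

Lemma starN (a : A) : star (- a) = - star a.
Proof. by apply: (addrI (star a)); rewrite -starD !subrr star0. Qed.

Context {H : hermModType A}.
Implicit Types x y z : H.

Lemma ipDl x y z : ip (x + y) z = ip x z + ip y z.
Proof. by rewrite -ip_star ipDr starD !ip_star. Qed.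

Lemma ip0r x : ip x 0 = 0.
Proof. by apply: (addrI (ip x 0)); rewrite -ipDr !addr0. Qed.

Lemma ip0l x : ip 0 x = 0.
Proof. by rewrite -ip_star ip0r star0. Qed.

Lemma ipNr x y : ip x (- y) = - ip x y.
Proof. by apply: (addrI (ip x y)); rewrite -ipDr !subrr ip0r. Qed.

Lemma ipNl x y : ip (- x) y = - ip x y.
Proof. by rewrite -ip_star ipNr starN ip_star. Qed.

Lemma ip_injl x y : (forall z, ip x z = ip y z) -> x = y.
Proof.
move=> exy; apply/eqP; rewrite -subr_eq0; apply/eqP/ip_nondeg => z.
by rewrite ipDl ipNl exy subrr.
Qed.

End HermitianModuleTheory.

Section DirectSum.
Context {R : realType} {A : cstarAlgType R} (H1 H2 : hermModType A).

Let dract (u : H1 * H2) (a : A) : H1 * H2 := (u.1 *< a, u.2 *< a).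
Let dip (u v : H1 * H2) : A := ip u.1 v.1 + ip u.2 v.2.

Fact dractDl u v a : dract (u + v) a = dract u a + dract v a.
Proof. by rewrite /dract !ractDl. Qed.
Fact dractDr u a b : dract u (a + b) = dract u a + dract u b.
Proof. by rewrite /dract !ractDr. Qed.
Fact dractM u a b : dract u (a ** b) = dract (dract u a) b.
Proof. by rewrite /dract !ractM. Qed.
Fact dractZl (k : R[i]) u a : dract (k *: u) a = k *: dract u a.
Proof. by rewrite /dract !ractZl. Qed.
Fact dractZr (k : R[i]) u a : dract u (k *: a) = k *: dract u a.
Proof. by rewrite /dract !ractZr. Qed.
Fact dipDr u v w : dip u (v + w) = dip u v + dip u w.
Proof. by rewrite /dip !ipDr addrACA. Qed.
Fact dipZr (k : R[i]) u v : dip u (k *: v) = k *: dip u v.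
Proof. by rewrite /dip !ipZr scalerDr. Qed.
Fact dip_ract u v a : dip u (dract v a) = dip u v ** a.
Proof. by rewrite /dip !ip_ract cmulDl. Qed.
Fact dip_star u v : star (dip u v) = dip v u.
Proof. by rewrite /dip starD !ip_star. Qed.
Fact dip_nondeg u : (forall v, dip u v = 0) -> u = 0.
Proof.
case: u => x y u0; congr pair; apply: ip_nondeg => z.
  by have := u0 (z, 0); rewrite /dip /= ip0r addr0.
by have := u0 (0, z); rewrite /dip /= ip0r add0r.
Qed.

HB.instance Definition _ := isHermitianModule.Build R A (H1 * H2)%type
  dractDl dractDr dractM dractZl dractZr dipDr dipZr dip_ract dip_star
  dip_nondeg.

End DirectSum.

(* The adjoint is a field of the record for convenience; it is determined by
   the underlying function, see adjointable_ext. *)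
Record adjointable (R : realType) (A : cstarAlgType R) (H K : hermModType A) :=
  Adjointable {
    afun :> H -> K;
    aadj : K -> H;
    aadjP : forall x y, ip (afun x) y = ip x (aadj y)
  }.

Section Adjointable.
Context {R : realType} {A : cstarAlgType R}.
Implicit Types H K G : hermModType A.

Lemma adjointable_ext H K (S T : adjointable H K) : S =1 T -> S = T.
Proof.
case: S T => [f f' fP] [g g' gP] /= /funext fg; rewrite {}fg in fP *.
have f'g' : f' = g'.
  apply/funext => y; apply: ip_injl => x.
  by rewrite -[LHS]ip_star -fP gP ip_star.
by rewrite {}f'g' in fP *; congr Adjointable; exact: Prop_irrelevance.
Qed.

Definition adj H K (T : adjointable H K) : adjointable K H.
Proof.
by apply: (@Adjointable _ _ _ _ (aadj T) T) => y x; rewrite -ip_star -aadjP ip_star.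
Defined.

Definition aid H : adjointable H H.
Proof. by apply: (@Adjointable _ _ _ _ id id). Defined.

Definition acomp H K G (S : adjointable K G) (T : adjointable H K) :
  adjointable H G.
Proof.
by apply: (@Adjointable _ _ _ _ (S \o T) (aadj T \o aadj S)) => x y /=; rewrite !aadjP.
Defined.

Definition azero H K : adjointable H K.
Proof.
by apply: (@Adjointable _ _ _ _ (fun=> 0) (fun=> 0)) => x y; rewrite ip0l ip0r.
Defined.

Definition aopp H K (T : adjointable H K) : adjointable H K.
Proof.
apply: (@Adjointable _ _ _ _ (fun x => - T x) (fun y => - aadj T y)) => x y.
by rewrite ipNl ipNr aadjP.
Defined.

Definition aadd H K (S T : adjointable H K) : adjointable H K.
Proof.
apply: (@Adjointable _ _ _ _ (fun x => S x + T x)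
  (fun y => aadj S y + aadj T y)) => x y.
by rewrite ipDl ipDr !aadjP.
Defined.

HB.instance Definition _ H K := gen_eqMixin (adjointable H K).
HB.instance Definition _ H K := gen_choiceMixin (adjointable H K).

Fact aaddA H K : associative (@aadd H K).
Proof. by move=> S T U; apply: adjointable_ext => x /=; rewrite addrA. Qed.
Fact aaddC H K : commutative (@aadd H K).
Proof. by move=> S T; apply: adjointable_ext => x /=; rewrite addrC. Qed.
Fact aadd0 H K : left_id (azero H K) (@aadd H K).
Proof. by move=> T; apply: adjointable_ext => x /=; rewrite add0r. Qed.
Fact aaddN H K : left_inverse (azero H K) (@aopp H K) (@aadd H K).
Proof. by move=> T; apply: adjointable_ext => x /=; rewrite addNr. Qed.

HB.instance Definition _ H K := GRing.isZmodule.Build (adjointable H K)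
  (@aaddA H K) (@aaddC H K) (@aadd0 H K) (@aaddN H K).

End Adjointable.

Notation "S \oL T" := (acomp S T) : ring_scope.

Section Operators.
Context {R : realType} {A : cstarAlgType R}.
Implicit Types H K : hermModType A.

Definition is_inverse H (T S : adjointable H H) : Prop :=
  S \oL T = aid H /\ T \oL S = aid H.

Definition invertible H (T : adjointable H H) : Prop :=
  exists S, is_inverse T S.

(* 0 if T is not invertible. *)
Definition ainv H (T : adjointable H H) : adjointable H H :=
  xget 0 [set S | is_inverse T S].

(* Positivity in the C*-algebra L(H), as cpositive. *)
Definition apositive H (T : adjointable H H) : Prop :=
  exists S : adjointable H H, T = adj S \oL S.

Definition positive_definite H (T : adjointable H H) : Prop :=
  apositive T /\ invertible T.

Definition is_wMP H K (M : adjointable K K) (N : adjointable H H)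
    (T : adjointable H K) (X : adjointable K H) : Prop :=
  [/\ T \oL X \oL T = T,
      X \oL T \oL X = X,
      adj (M \oL T \oL X) = M \oL T \oL X
    & adj (N \oL X \oL T) = N \oL X \oL T].

(* 0 if there is no weighted Moore-Penrose inverse. *)
Definition wMP H K (M : adjointable K K) (N : adjointable H H)
    (T : adjointable H K) : adjointable K H :=
  xget 0 [set X | is_wMP M N T X].

End Operators.

Section Blocks.
Context {R : realType} {A : cstarAlgType R}.
Implicit Types H K : hermModType A.

Definition arow H1 H2 K (S : adjointable H1 K) (T : adjointable H2 K) :
  adjointable (H1 * H2)%type K.
Proof.
apply: (@Adjointable _ _ _ _ (fun u : H1 * H2 => S u.1 + T u.2)
  (fun y => (aadj S y, aadj T y))) => u y.
by rewrite ipDl !aadjP.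
Defined.

Definition acol H K1 K2 (S : adjointable H K1) (T : adjointable H K2) :
  adjointable H (K1 * K2)%type.
Proof.
apply: (@Adjointable _ _ _ _ (fun x => (S x, T x) : K1 * K2)
  (fun v => aadj S v.1 + aadj T v.2)) => x v.
by rewrite ipDr -!aadjP.
Defined.

Definition ablock H1 H2 K1 K2
    (T11 : adjointable H1 K1) (T12 : adjointable H2 K1)
    (T21 : adjointable H1 K2) (T22 : adjointable H2 K2) :
  adjointable (H1 * H2)%type (K1 * K2)%type :=
  acol (arow T11 T12) (arow T21 T22).

End Blocks.

(* Main.v *)
Require Import Defs.
From HB Require Import structures.
From mathcomp Require Import all_boot all_order all_algebra.
From mathcomp Require Import complex.
From mathcomp Require Import boolp classical_sets reals topology normedtype.
From mathcomp Require Import ring lra.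
Import Order.TTheory GRing.Theory Num.Theory.
Import numFieldNormedType.Exports.
Local Open Scope ring_scope.
Local Open Scope classical_set_scope.

(** Once existence of the inverses of [A] and [C] is known, the formula is
    algebra. Write [X] for the right-hand side. As [C V = C Cd], the product
    [(A, B) X] is [A Ad + C Cd], which gives the first three Penrose equations;
    here [Cd A = 0] because the ranges of [A] and [C] are [M]-orthogonal, and
    [Ad C = 0]. For the fourth, the range of [N X] must be orthogonal to the
    kernel of [(A, B)], whose elements are [(q v1 - D v2, v2)] with
    [q = I - Ad A] and [C v2 = 0]; the two components of this condition are the
    ones that determine the first entry of [X] and [V]
    ([row_inverse_orthogonal], [is_wMP_row]).

    Three facts of analysis are behind the formula: positive definite weights
    have invertible corners and compressions, operators with closed range have
    weighted inverses, and [Rm] is invertible. All of them rest on one lemma,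
    [gram_invertible]: an adjointable [W] with a left inverse has an invertible
    [W^* W]. It applies to [N1] and to [S], the compressions of [N] to the first
    summand and to the graph of [- (D + q N1^-1 L)], and to
    [e^* M1 e + (1 - e)^* M2 (1 - e)] for an idempotent [e]
    ([diagonal_invertible]). The last operator yields orthogonal projections for
    a weight, hence weighted inverses from an inner inverse
    ([orthogonal_projection], [wMP_exists]), and it is up to the factor [N3^-1]
    the block diagonal part of [Rm] ([Rm_invertible]). The inner inverse exists
    because [T T^*] maps a closed range of [T] onto itself
    ([closed_range_inner_inverse]).

    Both surjectivity statements use the method of continuity
    ([onto_of_coercive]): [P + t] is bounded below uniformly in [t >= 0]. For
    [P = W^* W] this follows from [<x, (P + t) x> = <W x, W x> + t <x, x>] if the
    norm of a positive element of the C*-algebra does not decrease when another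
    one is added, and from the Cauchy-Schwarz inequality. On the range of [T] the
    lower bound of [T^*] comes from uniform boundedness ([weakly_bounded]).

    Monotonicity of the norm on elements [b^* b] amounts to the theorem that
    [b^* b] has nonnegative spectrum. It is obtained here without functional
    calculus. Positivity of a self-adjoint [p] means that [|c - p| <= c] for a
    scalar [c >= 0], which is stable under sums; polynomial approximate square
    roots ([upos_sqrt]) and the C*-identity for [x + i y] give the properties
    that relate it to squares and to the norm ([upos_sandwich]), and
    [upos_star_mul_contraction] replaces the usual argument with negative parts
    by estimates of powers. *)

Set Implicit Arguments.
Unset Strict Implicit.
Unset Printing Implicit Defensive.

(** * Deciding identities in abelian groups *)

(** Identities that become linear once products are expanded abound below, in
    rings that are not commutative and in spaces of operators between different
    modules. The tactic [zmod] settles them by comparing the integer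
    coefficients of the atoms on both sides. *)
Inductive zexp := ZVar of nat | ZAdd of zexp & zexp | ZOpp of zexp | ZZero.

Section AbelianGroupReflection.
Variable V : zmodType.

Fixpoint zeval (env : seq V) (e : zexp) : V :=
  match e with
  | ZVar i => env`_i
  | ZAdd e f => zeval env e + zeval env f
  | ZOpp e => - zeval env e
  | ZZero => 0
  end.

Fixpoint zcoef (e : zexp) (i : nat) : int :=
  match e with
  | ZVar j => (i == j)%:Z
  | ZAdd e f => zcoef e i + zcoef f i
  | ZOpp e => - zcoef e i
  | ZZero => 0
  end.

Lemma zevalE env e :
  zeval env e = \sum_(i < size env) env`_i *~ zcoef e i.
Proof.
elim: e => /= [j|e -> f ->|e ->|].
- have [lt_j|le_j] := ltnP j (size env); last first.
    rewrite nth_default // big1 // => i _.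
    by rewrite (_ : (_ == _) = false) // ltn_eqF // (leq_trans (ltn_ord i)).
  rewrite (bigD1 (Ordinal lt_j)) //= eqxx big1 ?addr0 // => i.
  by rewrite -val_eqE /= => /negPf->.
- by rewrite -big_split; apply: eq_bigr => i _; rewrite mulrzDr.
- by rewrite -sumrN; apply: eq_bigr => i _; rewrite mulrNz.
- by rewrite big1.
Qed.

Lemma zeval_eq env e f :
  all (fun i => zcoef e i == zcoef f i) (iota 0 (size env)) ->
  zeval env e = zeval env f.
Proof.
move=> /allP ef; rewrite !zevalE; apply: eq_bigr => i _; congr (_ *~ _).
by apply/eqP/ef; rewrite mem_iota /=.
Qed.

End AbelianGroupReflection.

(** Atoms are compared by unification: the same product may be written through
    different canonical structures. *)
Ltac zindex x env :=
  match env with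
  | ?y :: _ => let _ := match goal with _ => unify x y end in constr:(0%N)
  | _ :: ?env' => let n := zindex x env' in constr:(S n)
  end.
Ltac zmem x env :=
  match env with
  | ?y :: _ => let _ := match goal with _ => unify x y end in constr:(true)
  | _ :: ?env' => zmem x env'
  | _ => constr:(false)
  end.
Ltac zatoms t env :=
  lazymatch t with
  | (?x + ?y)%R => let env' := zatoms x env in zatoms y env'
  | (- ?x)%R => zatoms x env
  | 0%R => env
  | _ => lazymatch zmem t env with
         | true => env
         | false => constr:(t :: env)
         end
  end.
Ltac zreify t env :=
  lazymatch t with
  | (?x + ?y)%R => let e := zreify x env in let f := zreify y env in
                   constr:(ZAdd e f)
  | (- ?x)%R => let e := zreify x env in constr:(ZOpp e)
  | 0%R => constr:(ZZero)
  | _ => let n := zindex t env in constr:(ZVar n)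
  end.
Ltac zmod :=
  lazymatch goal with
  | |- @eq ?V ?x ?y =>
    let env := zatoms x (@nil V) in
    let env := zatoms y env in
    let e := zreify x env in
    let f := zreify y env in
    apply: (@zeval_eq _ env e f); lazy; reflexivity
  end.

(** * Real-valued norms and the unitization *)

Section RealNorm.
Context {R : realType}.
Local Notation C := R[i].
Implicit Types (V : normedModType C).

(** Norms of spaces over [R[i]] take values in [R[i]], where the order is
    partial; estimates are carried out with this real number instead. *)
Definition nm V (x : V) : R := complex.Re `|x|.

Lemma nmE V (x : V) : (nm x)%:C%C = `|x|.
Proof. by rewrite RRe_real ?normr_real. Qed.

Lemma nm_ge0 V (x : V) : 0 <= nm x.
Proof. by rewrite -lecR nmE normr_ge0. Qed.

Lemma nm_triangle V (x y : V) : nm (x + y) <= nm x + nm y.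
Proof. by rewrite -lecR rmorphD /= !nmE ler_normD. Qed.

Lemma nmN V (x : V) : nm (- x) = nm x.
Proof. by rewrite /nm normrN. Qed.

Lemma nm0 V : nm (0 : V) = 0.
Proof. by rewrite /nm normr0. Qed.

Lemma nm_eq0 V (x : V) : nm x = 0 -> x = 0.
Proof. by move=> x0; apply/eqP; rewrite -normr_eq0 -nmE x0. Qed.

Lemma nm_gt0 V (x : V) : x != 0 -> 0 < nm x.
Proof. by rewrite lt_def nm_ge0 andbT; apply: contra_neq => /nm_eq0. Qed.

Lemma nmB V (x y : V) : nm (x - y) <= nm x + nm y.
Proof. by rewrite -[nm y]nmN nm_triangle. Qed.

Lemma nmZ V (k : C) (x : V) : nm (k *: x) = complex.Re `|k| * nm x.
Proof.
by apply: (@complexI R); rewrite rmorphM /= !nmE normrZ.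
Qed.

Lemma nmZR V (t : R) (x : V) : nm (t%:C%C *: x) = `|t| * nm x.
Proof. by rewrite nmZ normc_def /= expr0n addr0 sqrtr_sqr. Qed.

Lemma nmZp V (t : R) (x : V) : 0 <= t -> nm (t%:C%C *: x) = t * nm x.
Proof. by move=> t0; rewrite nmZR ger0_norm. Qed.

Lemma half_double (V : lmodType C) (x : V) : (2^-1 : R)%:C%C *: (x + x) = x.
Proof.
have -> : x + x = 2%:R *: x by rewrite scaler_nat mulr2n.
rewrite scalerA -[2%:R : C](rmorph_nat (real_complex R)) -rmorphM.
by rewrite mulVf ?pnatr_eq0 // rmorph1 scale1r.
Qed.

End RealNorm.

Section Unitization.
Context {R : realType} (A : cstarAlgType R).
Local Notation C := R[i].

(** Positivity is handled through elements [c - a] with [c] a scalar, which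
    requires a unit; the C*-algebra need not have one. The unitization is
    normed by its action on [A] by left multiplication. *)
Definition unitization : Type := (A * C^o)%type.
HB.instance Definition _ := GRing.Lmodule.copy unitization (A * C^o)%type.
Local Notation U := unitization.

Definition umul (u v : U) : U :=
  (u.1 ** v.1 + u.2 *: v.1 + v.2 *: u.1, u.2 * v.2).
Definition uone : U := (0, 1).

Lemma cmul0l (a : A) : 0 ** a = 0.
Proof. by apply: (addrI (0 ** a)); rewrite -cmulDl !addr0. Qed.
Lemma cmul0r (a : A) : a ** 0 = 0.
Proof. by apply: (addrI (a ** 0)); rewrite -cmulDr !addr0. Qed.

Fact umulA : associative umul.
Proof.
move=> [a k] [b l] [c m]; rewrite /umul /=; congr pair; last by rewrite mulrA.
rewrite !cmulDl !cmulDr !cmulZl !cmulZr !scalerDr !scalerA cmulA.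
rewrite -!addrA; congr (_ + _).
rewrite [m * k]mulrC [m * l]mulrC; symmetry; rewrite addrCA [in LHS](addrCA ((k * l) *: c)).
by congr (_ + _); exact: addrCA.
Qed.
Fact umul1l : left_id uone umul.
Proof. by move=> [a k]; rewrite /umul /= cmul0l scale1r scaler0 add0r addr0 mul1r. Qed.
Fact umul1r : right_id uone umul.
Proof. by move=> [a k]; rewrite /umul /= cmul0r scale1r scaler0 !add0r mulr1. Qed.
Fact umulDl : left_distributive umul +%R.
Proof.
move=> [a k] [b l] [c m]; rewrite /umul; congr pair; last by rewrite /= mulrDl.
by rewrite /= cmulDl !scalerDl scalerDr [RHS]addrACA; congr (_ + _); exact: addrACA.
Qed.
Fact umulDr : right_distributive umul +%R.
Proof.
move=> [a k] [b l] [c m]; rewrite /umul; congr pair; last by rewrite /= mulrDr.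
by rewrite /= cmulDr !scalerDl scalerDr [RHS]addrACA; congr (_ + _); exact: addrACA.
Qed.
Fact uone_neq0 : uone != 0.
Proof. by apply/eqP => -[] /eqP; rewrite oner_eq0. Qed.
HB.instance Definition _ := GRing.Zmodule_isNzRing.Build U
  umulA umul1l umul1r umulDl umulDr uone_neq0.
Fact uscalerAl (k : C) (u v : U) : k *: (u * v) = (k *: u) * v.
Proof.
case: u v => [a l] [b m]; congr pair; last by rewrite /= [LHS]mulrA.
by rewrite /= !scalerDr cmulZl !scalerA; congr (_ + _ + _); rewrite mulrC.
Qed.
HB.instance Definition _ := GRing.Lmodule_isLalgebra.Build C U uscalerAl.
Fact uscalerAr (k : C) (u v : U) : k *: (u * v) = u * (k *: v).
Proof.
case: u v => [a l] [b m]; congr pair; last by rewrite /= [LHS]mulrCA.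
by rewrite /= !scalerDr cmulZr !scalerA; congr (_ + _ + _); rewrite mulrC.
Qed.
HB.instance Definition _ := GRing.Lalgebra_isAlgebra.Build C U uscalerAr.

Definition uemb (a : A) : U := (a, 0).
Definition uact (u : U) (x : A) : A := u.1 ** x + u.2 *: x.
Definition ustar (u : U) : U := (star u.1, u.2^*).

Lemma uemb_mull u x : u * uemb x = uemb (uact u x).
Proof. by congr pair; rewrite /= ?scale0r ?addr0 // [LHS]mulr0. Qed.

Lemma uactM u v x : uact (u * v) x = uact u (uact v x).
Proof. by have /(congr1 fst) := uemb_mull (u * v) x; rewrite -mulrA !uemb_mull. Qed.

Lemma uactDl u v x : uact (u + v) x = uact u x + uact v x.
Proof. by rewrite /uact /= cmulDl scalerDl addrACA. Qed.

Lemma uactZl k u x : uact (k *: u) x = k *: uact u x.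
Proof. by rewrite /uact /= cmulZl scalerDr scalerA. Qed.

Lemma uact1 x : uact 1 x = x.
Proof. by rewrite /uact /= cmul0l add0r scale1r. Qed.

Lemma uactNl u x : uact (- u) x = - uact u x.
Proof. by rewrite -scaleN1r uactZl scaleN1r. Qed.

Lemma ustarD : {morph ustar : u v / u + v}.
Proof. by move=> u v; congr pair; rewrite /= ?starD ?rmorphD. Qed.

Lemma ustarZ k u : ustar (k *: u) = k^* *: ustar u.
Proof. by congr pair; rewrite /= ?starZ // [LHS]rmorphM. Qed.

Lemma ustarM u v : ustar (u * v) = ustar v * ustar u.
Proof.
congr pair; rewrite /= ?[LHS]rmorphM /= 1?mulrC //.
by rewrite !starD !starZ starM -!addrA [X in _ + X]addrC.
Qed.

Lemma ustarK : involutive ustar.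
Proof. by move=> [a k]; congr pair; rewrite /= ?starK ?conjCK. Qed.

Lemma ustar1 : ustar 1 = 1.
Proof. by congr pair; rewrite /= ?star0 ?rmorph1. Qed.

Lemma ustar0 : ustar 0 = 0.
Proof. by congr pair; rewrite /= ?star0 ?rmorph0. Qed.

Lemma ustarN u : ustar (- u) = - ustar u.
Proof. by rewrite -scaleN1r ustarZ rmorphN rmorph1 scaleN1r. Qed.

Lemma ustarB : {morph ustar : u v / u - v}.
Proof. by move=> u v; rewrite ustarD ustarN. Qed.

Lemma ustarX u n : ustar (u ^+ n) = ustar u ^+ n.
Proof. by elim: n => [|n IH]; rewrite ?ustar1 // exprS exprSr ustarM IH. Qed.

Lemma conjR (t : R) : (t%:C%C : C)^* = t%:C%C.
Proof. by apply/CrealP/complex_realP; exists t. Qed.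

Lemma conji : ('i%C : C)^* = - 'i%C.
Proof. by rewrite -[LHS]/(conjc _); apply/eqP; rewrite eq_complex /= oppr0 !eqxx. Qed.

Lemma mulii : 'i%C * 'i%C = -1 :> C.
Proof. by rewrite -expr2 sqr_i. Qed.

Lemma nm_star (a : A) : nm (star a) = nm a.
Proof.
suff le_star (b : A) : nm b <= nm (star b).
  by apply/eqP; rewrite eq_le le_star -{2}[a]starK le_star.
have [->|b0] := eqVneq b 0; first by rewrite star0.
have bp := nm_gt0 b0.
rewrite -(ler_pM2r bp) -expr2 -lecR rmorphXn rmorphM /= !nmE -cnorm_star.
exact: cnormM.
Qed.

Lemma nm_cmul (a b : A) : nm (a ** b) <= nm a * nm b.
Proof. by rewrite -lecR rmorphM /= !nmE cnormM. Qed.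

Lemma nm_cstar (a : A) : nm (star a ** a) = nm a ^+ 2.
Proof. by apply: (@complexI R); rewrite rmorphXn /= !nmE cnorm_star. Qed.

(** The operator norm is only a seminorm here, as some nonzero elements act as 0
    when [A] already has a unit. Bounds suffice for what follows, so neither the
    supremum nor a quotient is formed. *)
Definition bnd (u : U) (c : R) := forall x : A, nm (uact u x) <= c * nm x.

Lemma bndD u v c d : bnd u c -> bnd v d -> bnd (u + v) (c + d).
Proof.
move=> uc vd x; rewrite uactDl mulrDl.
exact: le_trans (nm_triangle _ _) (lerD (uc x) (vd x)).
Qed.

Lemma bndN u c : bnd u c -> bnd (- u) c.
Proof. by move=> uc x; rewrite uactNl nmN. Qed.

Lemma bndB u v c d : bnd u c -> bnd v d -> bnd (u - v) (c + d).
Proof. by move=> uc vd; apply: bndD => //; apply: bndN. Qed.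

Lemma bndM u v c d : 0 <= c -> bnd u c -> bnd v d -> bnd (u * v) (c * d).
Proof.
move=> c0 uc vd x; rewrite uactM -mulrA.
exact: le_trans (uc _) (ler_wpM2l c0 (vd x)).
Qed.

Lemma bndZ (t : R) u c : 0 <= t -> bnd u c -> bnd (t%:C%C *: u) (t * c).
Proof. by move=> t0 uc x; rewrite uactZl nmZp // -mulrA ler_wpM2l. Qed.

Lemma bnd1 : bnd 1 1.
Proof. by move=> x; rewrite uact1 mul1r. Qed.

Lemma bnd0 : bnd 0 0.
Proof. by move=> x; rewrite -(scale0r 1) uactZl scale0r nm0 mul0r. Qed.

Lemma bndS u c d : c <= d -> bnd u c -> bnd u d.
Proof. by move=> cd uc x; exact: le_trans (uc x) (ler_wpM2r (nm_ge0 x) cd). Qed.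

Lemma bndX u c n : 0 <= c -> bnd u c -> bnd (u ^+ n) (c ^+ n).
Proof. by move=> c0 uc; elim: n => [|n IH]; [exact: bnd1 | rewrite !exprS; exact: bndM]. Qed.

Lemma bnd_ex u : exists2 c, 0 <= c & bnd u c.
Proof.
exists (nm u.1 + complex.Re `|u.2|).
  by rewrite addr_ge0 ?nm_ge0 // -lecR RRe_real ?normr_real // normr_ge0.
move=> x; rewrite mulrDl /uact; apply: le_trans (nm_triangle _ _) _.
by rewrite lerD ?nm_cmul // nmZ.
Qed.

Lemma bnd_closed u c : (forall e : R, 0 < e -> bnd u (c + e)) -> bnd u c.
Proof.
move=> uce x; apply/ler_addgt0Pr => e e0.
have x1 : 0 < nm x + 1 by rewrite ltr_wpDl ?nm_ge0.
apply: le_trans (uce (e / (nm x + 1)) _ x) _; first by rewrite divr_gt0.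
rewrite mulrDl lerD2l -mulrAC ler_pdivrMr // ler_wpM2l ?ltW //.
by rewrite ltrDl.
Qed.

Lemma uembB a b : uemb (a - b) = uemb a - uemb b.
Proof. by congr pair; rewrite /= subr0. Qed.

Lemma uembD a b : uemb (a + b) = uemb a + uemb b.
Proof. by congr pair; rewrite /= addr0. Qed.

Lemma uembZ (k : C) a : uemb (k *: a) = k *: uemb a.
Proof. by congr pair; rewrite /= scaler0. Qed.

Lemma uembM a b : uemb (a ** b) = uemb a * uemb b.
Proof. by rewrite uemb_mull /uact /= scale0r addr0. Qed.

Lemma uemb_star a : uemb (star a) = ustar (uemb a).
Proof. by congr pair; rewrite /= rmorph0. Qed.

Lemma uemb_inj : injective uemb.
Proof. by move=> a b []. Qed.

(** The C*-identity passes to the unitization because [|u x|^2] is the norm of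
    [x^* (u^* u x)]. *)
Lemma bnd_cstar u c : 0 <= c -> bnd (ustar u * u) (c ^+ 2) -> bnd u c.
Proof.
move=> c0 uc x; rewrite -(ler_pXn2r (n := 2)) ?nnegrE ?mulr_ge0 ?nm_ge0 //.
have -> : nm (uact u x) ^+ 2 = nm (star x ** uact (ustar u * u) x).
  rewrite -nm_cstar; congr nm; apply: uemb_inj.
  by rewrite !uembM !uemb_star -!uemb_mull ustarM !mulrA.
apply: le_trans (nm_cmul _ _) _; rewrite nm_star exprMn.
by rewrite [leRHS]mulrC [nm x ^+ 2]expr2 -mulrA ler_wpM2l ?nm_ge0 // mulrC.
Qed.

Lemma bnd_star u c : 0 <= c -> bnd u c -> bnd (ustar u) c.
Proof.
(* As |u^* x|^2 = |x^* u u^* x| <= c |x| |u^* x|, divide by |u^* x|. *)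
move=> c0 uc x; have [y0|y0] := eqVneq (uact (ustar u) x) 0.
  by rewrite y0 nm0 mulr_ge0 ?nm_ge0.
have yp := nm_gt0 y0.
rewrite -(ler_pM2r yp) -expr2 -nm_cstar.
have -> : star (uact (ustar u) x) ** uact (ustar u) x
          = star x ** uact u (uact (ustar u) x).
  apply: uemb_inj.
  by rewrite !uembM !uemb_star -!uemb_mull ustarM ustarK !mulrA.
apply: le_trans (nm_cmul _ _) _; rewrite nm_star -mulrA mulrCA.
by rewrite ler_wpM2l ?nm_ge0.
Qed.

Lemma bnd_emb a c : 0 <= c -> bnd (uemb a) c <-> nm a <= c.
Proof.
move=> c0; split=> [ac|ac x]; last first.
  rewrite /uact /= scale0r addr0; apply: le_trans (nm_cmul _ _) _.
  by rewrite ler_wpM2r ?nm_ge0.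
have [->|a0] := eqVneq a 0; first by rewrite nm0.
have ap := nm_gt0 a0.
rewrite -(ler_pM2r ap) -{3}[a]starK -expr2 -nm_star -nm_cstar starK.
by have := ac (star a); rewrite /uact /= scale0r addr0 nm_star.
Qed.

End Unitization.

(** * Growth of powers and approximate square roots *)

Section Growth.
Context {R : realType}.

Lemma bernoulli (x : R) n : 0 <= x -> 1 + n%:R * x <= (1 + x) ^+ n.
Proof.
move=> x0; elim: n => [|n IH]; first by rewrite mul0r addr0.
rewrite exprS; apply: le_trans (ler_wpM2l _ IH); last by rewrite addr_ge0.
have : 0 <= n%:R * x * x by rewrite !mulr_ge0.
rewrite -natr1; nra.
Qed.

Lemma pow_unbounded (x D : R) : 1 < x -> exists k, D <= x ^+ k.
Proof.
move=> x1; have xp : 0 < x - 1 by rewrite subr_gt0.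
pose k := Num.bound (D / (x - 1)); exists k.
have := bernoulli k (ltW xp); rewrite [1 + (x - 1)]addrC subrK.
apply: le_trans; rewrite ler_wpDl // -ler_pdivrMr //.
exact/ltW/unstable.ltr_bound.
Qed.

Lemma pow_small (r e : R) : 0 <= r -> r < 1 -> 0 < e -> exists k, r ^+ k <= e.
Proof.
move=> r0 r1 e0; have [->|rn0] := eqVneq r 0.
  by exists 1%N; rewrite expr1 ltW.
have rp : 0 < r by rewrite lt_def rn0.
have [|k] := @pow_unbounded r^-1 e^-1; first by rewrite invf_gt1.
by exists k; rewrite -lef_pV2 ?posrE ?exprn_gt0 // -exprVn.
Qed.

(** A constant factor is absorbed by an arbitrarily small increase of the base
    at exponents that are powers of 2, the ones to which the C*-identity gives
    access. *)
Lemma pow_gap (D c e : R) : 0 <= c -> 0 < e ->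
  exists k, D * c ^+ (2 ^ k) <= (c + e) ^+ (2 ^ k).
Proof.
move=> c0 e0; have [->|cn0] := eqVneq c 0.
  by exists 0%N; rewrite expn0 !expr1 mulr0 add0r ltW.
have cp : 0 < c by rewrite lt_def cn0.
have x1 : 1 < (c + e) / c by rewrite ltr_pdivlMr // mul1r ltrDl.
have [k Dk] := pow_unbounded D x1; exists k.
rewrite -ler_pdivlMr ?exprn_gt0 // -expr_div_n; apply: le_trans Dk _.
apply: (@ler_weXn2l R _ (ltW x1) k (2 ^ k)%N).
exact: ltnW (ltn_expl k (ltnSn 1)).
Qed.
End Growth.

Section SquareRoots.
Context {R : realType} {A : cstarAlgType R}.
Local Notation C := R[i].
Local Notation U := (unitization A).
Implicit Types (u v w p q x y z : U) (c d e n r t : R).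

Definition scal (t : R) : U := (t%:C%C : C) *: 1.

Lemma commZ (a : C) u v : GRing.comm u v -> GRing.comm u (a *: v).
Proof. by rewrite /GRing.comm -scalerAr -scalerAl => ->. Qed.

Lemma comm_scal u t : GRing.comm u (scal t).
Proof. exact/commZ/commr1. Qed.

Lemma scal_mull t u : scal t * u = t%:C%C *: u.
Proof. by rewrite /scal -scalerAl mul1r. Qed.

Lemma scal1 : scal 1 = 1.
Proof. by rewrite /scal scale1r. Qed.

Lemma scalD t r : scal (t + r) = scal t + scal r.
Proof. by rewrite /scal rmorphD scalerDl. Qed.

Lemma scalZ t r : t%:C%C *: scal r = scal (t * r).
Proof. by rewrite /scal rmorphM scalerA. Qed.

Lemma ustar_scal t : ustar (scal t) = scal t.
Proof. by rewrite /scal ustarZ conjR ustar1. Qed.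

Lemma bnd_scal t : 0 <= t -> bnd (scal t) t.
Proof. by move=> t0; rewrite -{2}[t]mulr1; apply: bndZ => //; exact: bnd1. Qed.

Lemma bnd_pow2 u c k : ustar u = u -> 0 <= c ->
  bnd (u ^+ (2 ^ k)) (c ^+ (2 ^ k)) -> bnd u c.
Proof.
move=> us c0; elim: k => // k IH uk; apply: IH; apply: bnd_cstar.
  exact: exprn_ge0.
by rewrite ustarX us -!exprD -exprM addnn -mul2n -expnS -expnSr.
Qed.

(** For self-adjoint elements the norm is the spectral radius: the C*-identity
    turns a bound on the [2^k]-th power into one on the element, and a constant
    factor disappears as [k] grows. *)
Lemma bnd_spectral u D c : ustar u = u -> 0 <= c ->
  (forall m, bnd (u ^+ m) (D * c ^+ m)) -> bnd u c.
Proof.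
move=> us c0 uD; apply: bnd_closed => e e0.
have [k Dk] := pow_gap D c0 e0.
apply: (bnd_pow2 (k := k)) => //; first by rewrite addr_ge0 // ltW.
exact: bndS Dk (uD _).
Qed.

(** A square root of [1 - z] is [1 - y] where [y] is the fixed point of
    [y |-> (z + y^2) / 2]. The iterates are polynomials in [z], hence commute
    with all that commutes with [z], and stopping after finitely many steps
    avoids any limit in the unitization. *)
Lemma sqrt_one_sub_approx z r e : ustar z = z -> bnd z r -> 0 <= r -> r < 1 -> 0 < e ->
  exists x, [/\ ustar x = x, forall w, GRing.comm w z -> GRing.comm w x
              & bnd (1 - z - x * x) e].
Proof.
move=> zs zr r0 r1 e0.
pose f (y : U) : U := (2^-1 : R)%:C%C *: (z + y * y : U).
pose ys m := iter m f 0.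
have ys0 : ys 0 = 0 by [].
have ysS m : ys m.+1 = f (ys m) by [].
have h0 : 0 <= 2^-1 :> R by rewrite invr_ge0.
have s_ys m : ustar (ys m) = ys m.
  elim: m => [|m IH]; first exact: ustar0.
  by rewrite ysS ustarZ conjR ustarD ustarM IH zs.
have c_ys w m : GRing.comm w z -> GRing.comm w (ys m).
  move=> wz; elim: m => [|m IH]; first exact: commr0.
  by rewrite ysS; apply: commZ; apply: commrD => //; apply: commrM.
have b_ys m : bnd (ys m) r.
  elim: m => [|m IH]; first by rewrite ys0; apply: (bndS r0); exact: bnd0.
  rewrite ysS; apply: (bndS _ (bndZ h0 (bndD zr (bndM r0 IH IH)))); nra.
have d_ys m : bnd (ys m.+1 - ys m) (r ^+ m.+1).
  elim: m => [|m IH].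
    rewrite ysS ys0 subr0 expr1 /f mulr0 addr0.
    by apply: (bndS _ (bndZ h0 zr)); nra.
  have -> : ys m.+2 - ys m.+1
    = (2^-1 : R)%:C%C *: ((ys m.+1 - ys m) * (ys m.+1 + ys m)).
    rewrite [in LHS]ysS [X in _ - X]ysS -scalerBr; congr (_ *: _).
    have cc : GRing.comm (ys m) (ys m.+1)
      by exact: (c_ys _ _ (commr_sym (c_ys _ _ (commr_refl z)))).
    by rewrite mulrDr !mulrBl cc; zmod.
  apply: (bndS _ (bndZ h0 (bndM _ IH (bndD (b_ys _) (b_ys _))))).
    by rewrite [r ^+ m.+2]exprSr; have := exprn_ge0 m.+1 r0; nra.
  exact: exprn_ge0.
have [k rk] : exists k, r ^+ k <= e / 2 by apply: pow_small; rewrite ?divr_gt0.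
exists (1 - ys k); split.
- by rewrite ustarB ustar1 s_ys.
- by move=> w wz; apply: commrB; [exact: commr1 | exact: c_ys].
have -> : 1 - z - (1 - ys k) * (1 - ys k) = - (2%:R *: (ys k.+1 - ys k)).
  rewrite ysS /f scalerBr scalerA.
  have -> : 2%:R * (2^-1 : R)%:C%C = 1 :> C.
    by rewrite -[2%:R](rmorph_nat (real_complex R)) -rmorphM divff ?pnatr_eq0 // rmorph1.
  rewrite scale1r mulrBr !mulrBl !mul1r mulr1 scaler_nat mulr2n; zmod.
apply: bndN; rewrite -[2%:R](rmorph_nat (real_complex R)).
by apply: (bndS _ (bndZ _ (d_ys k))); rewrite // exprS; nra.
Qed.
End SquareRoots.

(** * Positive elements of the unitization *)

Section PositiveCone.
Context {R : realType} {A : cstarAlgType R}.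
Local Notation U := (unitization A).
Implicit Types (u v w p q x y z : U) (c d e n r t : R).

(** Positivity without spectra: for self-adjoint [p] the condition says that
    the spectrum lies in [[0, 2c]]. It is visibly stable under addition. *)
Definition upos p :=
  ustar p = p /\ exists2 c, 0 <= c & bnd (scal c - p) c.

(** Up to the scalar [e / 3], a multiple of [p] has the form [1 - z] with the
    norm of [z] less than 1. *)
Lemma upos_sqrt p e : upos p -> 0 < e ->
  exists x, [/\ ustar x = x, forall w, GRing.comm w p -> GRing.comm w x
              & bnd (p - x * x) e].
Proof.
move=> [ps [c c0 pc]] e0.
have e3 : 0 < e / 3 by rewrite divr_gt0.
pose d := c + e / 3.
have d0 : 0 < d by rewrite ltr_wpDl.
have di0 : 0 <= d^-1 by rewrite invr_ge0 ltW.
pose z := (d^-1)%:C%C *: (scal c - p).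
have zr : bnd z (d^-1 * c) by apply: bndZ.
have [] := @sqrt_one_sub_approx _ _ z (d^-1 * c) (e / 3 / d) _ zr.
- by rewrite ustarZ conjR ustarB ustar_scal ps.
- by rewrite mulr_ge0.
- by rewrite mulrC ltr_pdivrMr // mul1r ltrDl.
- by rewrite divr_gt0.
move=> x [xs xc xb]; exists ((Num.sqrt d)%:C%C *: x); split.
- by rewrite ustarZ conjR xs.
- move=> w wp; apply/commZ/xc/commZ/commrB => //; exact: comm_scal.
rewrite -scalerAl -scalerAr scalerA -rmorphM -expr2 sqr_sqrtr ?ltW //.
have -> : p - d%:C%C *: (x * x) = d%:C%C *: (1 - z - x * x) - scal (e / 3).
  rewrite !scalerBr /z scalerA -rmorphM divff ?gt_eqF // scale1r.
  by rewrite -[d%:C%C *: 1]/(scal d) /d scalD; zmod.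
apply: (bndS _ (bndB (bndZ (ltW d0) xb) (bnd_scal (ltW e3)))).
by rewrite mulrC divfK ?gt_eqF //; nra.
Qed.

Lemma upos_bnd p n : ustar p = p -> bnd p n -> 0 <= n -> upos (scal n - p).
Proof.
move=> ps pn n0; split; first by rewrite ustarB ustar_scal ps.
by exists n => //; rewrite opprB addrC subrK.
Qed.

(** For commuting self-adjoint [x] and [y], [x^2 + y^2] is [w^* w] with
    [w = x + i y], and [x] is the real part of [w]. *)
Lemma bnd_comm_sq x y n : ustar x = x -> ustar y = y -> GRing.comm x y ->
  0 <= n -> bnd (x * x + y * y) n -> bnd (x * x) n.
Proof.
move=> xs ys xy n0 xyn; pose w := x + 'i%C *: y.
have ws : ustar w = x - 'i%C *: y by rewrite ustarD ustarZ xs ys conji scaleNr.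
have wn : bnd w (Num.sqrt n).
  apply: bnd_cstar; first exact: sqrtr_ge0.
  rewrite sqr_sqrtr //; move: xyn; congr bnd.
  rewrite ws /w mulrDr !mulrBl -!scalerAl -!scalerAr -xy scalerA.
  by rewrite mulii scaleN1r; zmod.
have wsn : bnd (ustar w) (Num.sqrt n) by apply: bnd_star; rewrite ?sqrtr_ge0.
have xn : bnd x (Num.sqrt n).
  have -> : x = (2^-1 : R)%:C%C *: (w + ustar w).
    rewrite -[LHS]half_double; congr (_ *: _).
    by rewrite ws /w; zmod.
  have h0 : 0 <= 2^-1 :> R by rewrite invr_ge0.
  by apply: (bndS _ (bndZ h0 (bndD wn wsn))); lra.
by rewrite -(sqr_sqrtr n0) expr2; apply: bndM => //; exact: sqrtr_ge0.
Qed.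

(** Approximate roots [x] of [p] and [y] of [n - p] commute and
    [x^2 + y^2] is close to [n], so [bnd_comm_sq] applies. *)
Lemma upos_sandwich p n : upos p -> upos (scal n - p) -> 0 <= n -> bnd p n.
Proof.
move=> pp pnp n0; apply: bnd_closed => e e0.
have e3 : 0 < e / 3 by rewrite divr_gt0.
have [x [xs xc xb]] := upos_sqrt pp e3.
have [y [ys yc yb]] := upos_sqrt pnp e3.
have xy : GRing.comm x y.
  apply: yc; apply: commrB; first exact: comm_scal.
  by apply/commr_sym/xc.
have n'0 : 0 <= n + (e / 3 + e / 3) by rewrite !addr_ge0 // ltW.
have xyn : bnd (x * x + y * y) (n + (e / 3 + e / 3)).
  have -> : x * x + y * y
    = scal n - ((p - x * x) + (scal n - p - y * y)) by zmod.
  by apply: bndB; [exact: bnd_scal | exact: bndD].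
have -> : p = (p - x * x) + x * x by zmod.
apply: (bndS _ (bndD xb (bnd_comm_sq xs ys xy n'0 xyn))); lra.
Qed.

Lemma upos_sq x : ustar x = x -> upos (x * x).
Proof.
move=> xs; have [c c0 xc] := bnd_ex (x * x).
have xxs : ustar (x * x) = x * x by rewrite ustarM xs.
split=> //; exists c => //; apply: bnd_closed => e e0.
have e3 : 0 < e / 3 by rewrite divr_gt0.
have [y [ys yc yb]] := upos_sqrt (upos_bnd xxs xc c0) e3.
have xy : GRing.comm y x.
  apply/commr_sym/yc/commrB; first exact: comm_scal.
  by apply: commrM; exact: commr_refl.
have n'0 : 0 <= c + e / 3 by rewrite addr_ge0 // ltW.
have yxn : bnd (y * y + x * x) (c + e / 3).
  have -> : y * y + x * x = scal c - (scal c - x * x - y * y) by zmod.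
  by apply: bndB => //; exact: bnd_scal.
have -> : scal c - x * x = (scal c - x * x - y * y) + y * y by zmod.
apply: (bndS _ (bndD yb (bnd_comm_sq ys xs xy n'0 yxn))); lra.
Qed.

Lemma upos_add p q : upos p -> upos q -> upos (p + q).
Proof.
move=> [ps [c c0 pc]] [qs [d d0 qd]]; split; first by rewrite ustarD ps qs.
exists (c + d); first exact: addr_ge0.
have -> : scal (c + d) - (p + q) = (scal c - p) + (scal d - q).
  by rewrite scalD; zmod.
exact: bndD.
Qed.

Lemma uposZ t p : 0 <= t -> upos p -> upos (t%:C%C *: p).
Proof.
move=> t0 [ps [c c0 pc]]; split; first by rewrite ustarZ conjR ps.
exists (t * c); first exact: mulr_ge0.
by rewrite -scalZ -scalerBr; exact: bndZ.
Qed.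

Lemma upos_norm p q n : upos p -> upos q -> 0 <= n -> bnd (p + q) n -> bnd p n.
Proof.
move=> pp pq n0 pqn; apply: upos_sandwich => //.
have -> : scal n - p = (scal n - (p + q)) + q by zmod.
apply: upos_add => //; apply: upos_bnd => //.
by case: (upos_add pp pq).
Qed.

Lemma upos_le p n : upos p -> bnd p n -> 0 <= n -> bnd (scal n - p) n.
Proof.
move=> pp pn n0; apply: upos_sandwich => //.
  by apply: upos_bnd => //; case: pp.
by have -> : scal n - (scal n - p) = p by zmod.
Qed.

(** The constant witnessing positivity may be any bound of the norm
    ([upos_le]); a single one serves all approximants. *)
Lemma upos_closed p : ustar p = p ->
  (forall e, 0 < e -> exists2 q, upos q & bnd (p - q) e) -> upos p.
Proof.
move=> ps pq; have [c c0 pc] := bnd_ex p.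
split=> //; exists (c + 1); first exact: addr_ge0.
apply: bnd_closed => e e0.
pose d := Num.min e 1; have d0 : 0 < d by rewrite lt_min e0 ltr01.
have [q qp pqd] := pq _ d0.
have qn : bnd q (c + 1).
  have -> : q = p - (p - q) by zmod.
  by apply: (bndS _ (bndB pc pqd)); rewrite lerD2l ge_min lexx orbT.
have -> : scal (c + 1) - p = (scal (c + 1) - q) - (p - q) by zmod.
apply: (bndS _ (bndB (upos_le qp qn _) pqd)); last exact: addr_ge0.
by rewrite lerD2l ge_min lexx.
Qed.

Lemma upos_mul_comm p k : upos p -> ustar k = k -> GRing.comm k p -> upos (k * p * k).
Proof.
move=> pp ks kp; have ps : ustar p = p by case: pp.
apply: upos_closed; first by rewrite !ustarM ks ps mulrA.
move=> e e0; have [c c0 kc] := bnd_ex k.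
have d0 : 0 < (c + 1) * (c + 1) by rewrite mulr_gt0 // ltr_wpDl.
have [x [xs xc xb]] := upos_sqrt pp (divr_gt0 e0 d0).
have kx : GRing.comm k x by apply: xc.
have kc1 : bnd k (c + 1) by apply: bndS kc; rewrite lerDl.
have c10 : 0 <= c + 1 by rewrite addr_ge0.
exists ((k * x) * (k * x)).
  by apply: upos_sq; rewrite ustarM ks xs kx.
have -> : k * p * k - k * x * (k * x) = k * (p - x * x) * k.
  by rewrite mulrBr mulrBl {2}kx !mulrA.
apply: (bndS _ (bndM _ (bndM c10 kc1 xb) kc1)); last first.
  by rewrite mulr_ge0 // divr_ge0 ?ltW.
by rewrite mulrAC [leLHS]mulrC divfK ?gt_eqF.
Qed.

Lemma upos_exp v j : upos v -> upos (v ^+ j).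
Proof.
move=> pv; have vs : ustar v = v by case: pv.
have -> : v ^+ j = v ^+ j./2 * v ^+ (odd j) * v ^+ j./2.
  by rewrite -!exprD addnAC addnn addnC odd_double_half.
case: (odd j); rewrite ?expr1 ?expr0 ?mulr1.
  apply: upos_mul_comm => //; first by rewrite ustarX vs.
  exact/commr_sym/commrX/commr_refl.
by apply: upos_sq; rewrite ustarX vs.
Qed.

End PositiveCone.

(** * The elements a^* a are positive *)

Section StarSquares.
Context {R : realType} {A : cstarAlgType R}.
Local Notation U := (unitization A).
Implicit Types (a b u v w p q x y z : U) (c d e n r t : R).

(** A norm version of the fact that [b^* b] and [b b^*] have the same nonzero
    spectrum. With [w = c - b b^*] and [w' = c - b^* b] one has
    [w'^(m+1) = c w'^m - b^* w^m b], so the powers of [w'] grow no faster than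
    those of [w], and [bnd_spectral] compares the norms. *)
Lemma upos_swap b e : 0 < e -> upos (b * ustar b + scal e) ->
  upos (ustar b * b + scal e).
Proof.
move=> e0 pb; have [c c0 bc] := bnd_ex (b * ustar b + scal e).
have [B B0 bB] := bnd_ex b.
pose n := c + e.
have n0 : 0 < n by rewrite ltr_wpDl.
have wn : bnd (scal c - b * ustar b) n.
  have -> : scal c - b * ustar b = scal n - (b * ustar b + scal e).
    by rewrite /n scalD; zmod.
  apply: upos_le => //; last exact: ltW.
  by apply: bndS bc; rewrite lerDl ltW.
set w := scal c - _ in wn; pose w' := scal c - ustar b * b.
have w's : ustar w' = w' by rewrite ustarB ustar_scal ustarM ustarK.
have bw m : b * w' ^+ m = w ^+ m * b.
  elim: m => [|m IH]; first by rewrite mulr1 mul1r.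
  rewrite exprS exprSr mulrA -(mulrA _ w b).
  have -> : w * b = b * w' by rewrite mulrBr mulrBl mulrA comm_scal.
  by rewrite mulrA -IH -!mulrA -exprSr exprS.
(* D is chosen with B^2 <= D e: the induction on m below needs
   D c + B^2 <= D (c + e). *)
pose D := 1 + B * B / e.
have D1 : 1 <= D by rewrite lerDl divr_ge0 ?mulr_ge0 // ltW.
have De : B * B <= D * e.
  by rewrite mulrDl divfK ?gt_eqF // lerDr mul1r ltW.
have w'm m : bnd (w' ^+ m) (D * n ^+ m).
  elim: m => [|m IH]; first by rewrite !expr0 mulr1; apply: (bndS D1); exact: bnd1.
  have -> : w' ^+ m.+1 = c%:C%C *: w' ^+ m - ustar b * w ^+ m * b.
    by rewrite exprS {1}/w' mulrBl scal_mull -!mulrA bw.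
  have nm0 : 0 <= n ^+ m by rewrite exprn_ge0 ?ltW.
  apply: (bndS _ (bndB (bndZ c0 IH) (bndM _ (bndM B0 (bnd_star B0 bB)
    (bndX _ (ltW n0) wn)) bB))); last by rewrite mulr_ge0.
  rewrite exprS; move: (n ^+ m) nm0 => N /ler_wpM2r /(_ _ _ De).
  by rewrite /n; nra.
have w'n : bnd w' n by apply: bnd_spectral w'm => //; exact: ltW.
split; first by rewrite ustarD ustarM ustarK ustar_scal.
exists n; first exact: ltW.
have -> // : scal n - (ustar b * b + scal e) = w'.
by rewrite /n /w' scalD; zmod.
Qed.

(** With [b = x + i y] this sum is [2 (x^2 + y^2)]; the proof uses [2 x] and
    [- 2 y]. *)
Lemma upos_hermitian_sum b : upos (ustar b * b + b * ustar b).
Proof.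
have h0 : 0 <= 2^-1 :> R by rewrite invr_ge0.
pose x := b + ustar b; pose y := 'i%C *: (b - ustar b).
have xs : ustar x = x by rewrite ustarD ustarK addrC.
have ys : ustar y = y.
  by rewrite ustarZ ustarB ustarK conji scaleNr -scalerN opprB.
have -> : ustar b * b + b * ustar b = (2^-1 : R)%:C%C *: (x * x + y * y).
  rewrite -[LHS]half_double; congr (_ *: _).
  rewrite /x /y -scalerAl -scalerAr scalerA mulii scaleN1r.
  by rewrite !(mulrDl, mulrDr, mulrBl, mulrBr, mulNr, mulrN); zmod.
by apply/uposZ/upos_add/upos_sq => //; exact: upos_sq.
Qed.

(** Put [h = a^* a], [v = 1 - h] and [b = a v^m], so that
    [b^* b = h v^(2m)]. Now [1 - b^* b] is positive, because
    [1 - (1 - v) v^k = v + sum_(j < k) (1 - v) v^j (1 - v)] and [v] is positive.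
    Adding [b^* b + b b^*] shows that [1 + b b^*] is positive, and by
    [upos_swap] so is [1 + b^* b]. Hence the elements [h v^k] are bounded
    uniformly in [k], the powers [v^k = 1 - sum_(j < k) h v^j] grow at most
    linearly, and the norm of [v] is at most 1 by [bnd_spectral]: this is
    positivity of [h]. *)
Lemma upos_star_mul_contraction a : bnd a 1 -> upos (ustar a * a).
Proof.
move=> a1; pose h := ustar a * a; pose v := 1 - h.
have hs : ustar h = h by rewrite ustarM ustarK.
have vs : ustar v = v by rewrite ustarB ustar1 hs.
have h1 : bnd h 1.
  by rewrite -[1]mulr1; apply: bndM => //; exact: bnd_star.
have pv : upos v by rewrite /v -scal1; apply: upos_bnd.
have v2 : bnd v 2.
  have -> : 2 = 1 + 1 :> R by rewrite -[2]/(2%:R) mulr2n.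
  by apply: bndB => //; exact: bnd1.
have hv : GRing.comm h v.
  by apply: commrB; [exact: commr1 | exact: commr_refl].
have p1 m : upos (1 - h * v ^+ m).
  elim: m => [|m IH]; first by rewrite mulr1.
  have -> : 1 - h * v ^+ m.+1 = (1 - h * v ^+ m) + h * v ^+ m * h.
    rewrite exprSr {3}/v !mulrBr mulr1 mulrA; zmod.
  apply: upos_add => //; apply: upos_mul_comm => //; first exact: upos_exp.
  exact: commrX.
have b3 m : bnd (h * v ^+ (m + m)) 3.
  pose b := a * v ^+ m.
  have bb : ustar b * b = h * v ^+ (m + m).
    rewrite ustarM ustarX vs -mulrA (mulrA _ a) -/h mulrA.
    by rewrite -(commrX m hv) -mulrA exprD.
  have pb : upos (ustar b * b + scal 1).
    apply: upos_swap => //.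
    have -> : b * ustar b + scal 1
        = (ustar b * b + b * ustar b) + (1 - h * v ^+ (m + m)).
      by rewrite scal1 -bb; zmod.
    by apply: upos_add => //; exact: upos_hermitian_sum.
  have : bnd (ustar b * b + scal 1) 2.
    apply: (upos_norm pb (p1 (m + m)%N)) => //.
    have -> : ustar b * b + scal 1 + (1 - h * v ^+ (m + m)) = scal 1 + scal 1.
      by rewrite bb scal1; zmod.
    by rewrite -scalD -[2]/(1 + 1); apply: bnd_scal; rewrite addr_ge0.
  rewrite bb scal1 => b2.
  have -> : h * v ^+ (m + m) = (h * v ^+ (m + m) + 1) - 1 by zmod.
  by apply: (bndS _ (bndB b2 (@bnd1 _ A))); lra.
have b6 m : bnd (h * v ^+ m) 6.
  rewrite -(odd_double_half m) addnC -addnn exprD mulrA.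
  case: (odd m) => /=.
    by rewrite expr1; apply: (bndS _ (bndM _ (b3 _) v2)) => //; lra.
  by rewrite mulr1; apply: (bndS _ (b3 _)); lra.
split=> //; exists 1 => //; rewrite scal1 -/v.
apply: bnd_closed => e e0.
(* With D e >= 6, adding 6 is at most multiplication of D (1 + e)^m by 1 + e. *)
pose D := 1 + 6 / e.
have D1 : 1 <= D by rewrite lerDl divr_ge0 // ltW.
have De : 6 <= D * e by rewrite mulrDl divfK ?gt_eqF // lerDr mul1r ltW.
have e1 : 0 <= 1 + e by rewrite addr_ge0 // ltW.
apply: (@bnd_spectral _ _ v D) => // m.
elim: m => [|m IH]; first by rewrite !expr0 mulr1; apply: (bndS D1); exact: bnd1.
have -> : v ^+ m.+1 = v ^+ m - h * v ^+ m.
  by rewrite exprS {1}/v mulrBl mul1r.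
apply: (bndS _ (bndB IH (b6 m))).
have : 1 <= (1 + e) ^+ m by rewrite exprn_ege1 // lerDl ltW.
by rewrite exprS; nra.
Qed.

Lemma upos_star_mul a : upos (ustar a * a).
Proof.
have [c c0 ac] := bnd_ex a; have c1 : 0 < c + 1 by rewrite ltr_wpDl.
pose b := ((c + 1)^-1)%:C%C *: a.
have -> : ustar a * a = ((c + 1) * (c + 1))%:C%C *: (ustar b * b).
  rewrite ustarZ conjR -scalerAl -scalerAr !scalerA -!rmorphM.
  by rewrite mulfK ?gt_eqF // mulfV ?gt_eqF // rmorph1 scale1r.
apply: uposZ; first by rewrite mulr_ge0 ?ltW.
apply: upos_star_mul_contraction.
apply: (bndS _ (bndZ _ ac)); last by rewrite invr_ge0 ltW.
by rewrite mulrC ler_pdivrMr // mul1r lerDl.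
Qed.

Lemma upos_conj u p : upos p -> upos (ustar u * p * u).
Proof.
move=> pp; have ps : ustar p = p by case: pp.
apply: upos_closed; first by rewrite !ustarM ps ustarK mulrA.
move=> e e0; have [c c0 kc] := bnd_ex u.
have c10 : 0 <= c + 1 by rewrite addr_ge0.
have c11 : 0 < c + 1 by rewrite ltr_wpDl.
have d0 : 0 < (c + 1) * (c + 1) by rewrite mulr_gt0.
have [x [xs xc xb]] := upos_sqrt pp (divr_gt0 e0 d0).
have kc1 : bnd u (c + 1) by apply: bndS kc; rewrite lerDl.
exists (ustar (x * u) * (x * u)); first exact: upos_star_mul.
have -> : ustar u * p * u - ustar (x * u) * (x * u) = ustar u * (p - x * x) * u.
  by rewrite ustarM xs mulrBr mulrBl !mulrA.
apply: (bndS _ (bndM _ (bndM c10 (bnd_star c10 kc1) xb) kc1)); last first.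
  by rewrite mulr_ge0 // divr_ge0 ?ltW.
by rewrite mulrAC [leLHS]mulrC divfK ?gt_eqF.
Qed.

End StarSquares.

(** * Positivity and the Cauchy-Schwarz inequality in modules *)

Section PositiveElements.
Context {R : realType} {A : cstarAlgType R}.
Local Notation U := (unitization A).
Implicit Types (a b : A).

(** Unlike the form [b^* b] in the definition of [cpositive], this property is
    visibly stable under sums, as direct sums of modules require. *)
Definition posA a := upos (uemb a).

Lemma cpositive_posA a : cpositive a -> posA a.
Proof. by move=> [b ->]; rewrite /posA uembM uemb_star; exact: upos_star_mul. Qed.

Lemma posAD a b : posA a -> posA b -> posA (a + b).
Proof. by rewrite /posA uembD; exact: upos_add. Qed.

Lemma posAZ (t : R) a : 0 <= t -> posA a -> posA (t%:C%C *: a).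
Proof. by rewrite /posA uembZ; exact: uposZ. Qed.

Lemma le_nm_posA a b : posA a -> posA b -> nm a <= nm (a + b).
Proof.
move=> pa pb; apply/(bnd_emb _ (nm_ge0 _))/(upos_norm pa pb (nm_ge0 _)).
by rewrite -uembD; apply/bnd_emb; rewrite ?nm_ge0.
Qed.
End PositiveElements.

Section HermitianModules.
Context {R : realType} {A : cstarAlgType R}.
Implicit Types (H K : hermModType A).

Lemma ipZl H (k : R[i]) (x y : H) : ip (k *: x) y = k^* *: ip x y :> A.
Proof. by rewrite -ip_star ipZr starZ ip_star. Qed.

Lemma ipBr H (x y z : H) : ip x (y - z) = ip x y - ip x z :> A.
Proof. by rewrite ipDr ipNr. Qed.

Lemma ipBl H (x y z : H) : ip (x - y) z = ip x z - ip y z :> A.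
Proof. by rewrite ipDl ipNl. Qed.

Lemma ip_ractl H (x y : H) (a : A) : ip (x *< a) y = star a ** ip x y.
Proof. by rewrite -ip_star ip_ract starM ip_star. Qed.

Lemma aadjPr H K (T : adjointable H K) x y : ip y (T x) = ip (adj T y) x :> A.
Proof. by rewrite -ip_star aadjP ip_star. Qed.

Lemma aadjE H K (T : adjointable H K) x y : ip (T x) y = ip x (adj T y) :> A.
Proof. exact: aadjP. Qed.

Lemma adjK H K (T : adjointable H K) : adj (adj T) = T.
Proof. exact: adjointable_ext. Qed.

Lemma aD H K (T : adjointable H K) : {morph T : x y / x + y}.
Proof. by move=> x y; apply: ip_injl => z; rewrite aadjE !ipDl !aadjE. Qed.

Lemma aZ H K (T : adjointable H K) k : {morph T : x / k *: x}.
Proof. by move=> x; apply: ip_injl => z; rewrite aadjE !ipZl !aadjE. Qed.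

Lemma aN H K (T : adjointable H K) : {morph T : x / - x}.
Proof. by move=> x; rewrite -scaleN1r aZ scaleN1r. Qed.

Lemma aB H K (T : adjointable H K) : {morph T : x y / x - y}.
Proof. by move=> x y; rewrite aD aN. Qed.

Lemma a0 H K (T : adjointable H K) : T 0 = 0.
Proof. by rewrite -[0 in LHS](scale0r 0) aZ scale0r. Qed.

Definition ip_positive H := forall x : H, posA (ip x x : A).

End HermitianModules.

Section HilbertModules.
Context {R : realType} {A : cstarAlgType R}.
Implicit Types (H K : hilbertModType A).

Lemma hilbert_ip_positive H : @ip_positive R A H.
Proof. by move=> x; apply/cpositive_posA/ip_pos. Qed.

Lemma prod_ip_positive (H K : hermModType A) :
  ip_positive H -> ip_positive K -> @ip_positive R A (H * K)%type.
Proof. by move=> pH pK x; apply: posAD. Qed.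

Lemma nm_ip H (x : H) : nm (ip x x : A) = nm x ^+ 2.
Proof. by apply: (@complexI R); rewrite rmorphXn /= !nmE norm_ip. Qed.

(** Positivity of the inner square of [x - y <y, x> / |y|^2], where
    [<y, y>] is replaced by the larger scalar [|y|^2], bounds
    [<y, x>^* <y, x> / |y|^2] by [<x, x>]. *)
Lemma cauchy_schwarz H (x y : H) : nm (ip x y : A) <= nm x * nm y.
Proof.
have [->|y0] := eqVneq y 0; first by rewrite ip0r !nm0 mulr0.
have yp := nm_gt0 y0.
pose n := nm y ^+ 2; have n0 : 0 < n by rewrite exprn_gt0.
pose c : A := ip y x; pose t := n^-1; have t0 : 0 <= t by rewrite invr_ge0 ltW.
have cs : star c = ip x y by rewrite ip_star.
pose p : A := t%:C%C *: (star c ** c).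
have pp : posA p by apply/posAZ => //; apply: cpositive_posA; exists c.
have pq : posA (ip x x - p : A).
  pose z := x - y *< (t%:C%C *: c).
  have -> : ip x x - p = (ip z z : A)
      + ((t * t)%:C%C *: (n%:C%C *: (star c ** c) - star c ** ip y y ** c)).
    rewrite /z ipBl !ipBr !ip_ractl !ip_ract -/c -cs starZ conjR.
    rewrite !(cmulZl, cmulZr) scalerBr !scalerA -!rmorphM /p -mulrA mulVf ?gt_eqF //.
    by rewrite mulr1 cmulA; zmod.
  apply: posAD; first exact: hilbert_ip_positive.
  apply: posAZ; first exact: mulr_ge0.
  rewrite /posA uembB uembZ !uembM uemb_star.
  have -> : n%:C%C *: (ustar (uemb c) * uemb c)
      - ustar (uemb c) * uemb (ip y y) * uemb c
    = ustar (uemb c) * (scal n - uemb (ip y y)) * uemb c.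
    by rewrite mulrBr mulrBl comm_scal -mulrA scal_mull scalerAl mulrA.
  apply: upos_conj; apply: upos_bnd => //; last exact: ltW.
    by rewrite -uemb_star ip_star.
  by apply/bnd_emb; rewrite ?nm_ip // ltW.
have := le_nm_posA pp pq; rewrite [p + _]addrC subrK nm_ip nmZp //.
rewrite nm_cstar -nm_star cs /t mulrC ler_pdivrMr // /n -exprMn.
by rewrite ler_pXn2r ?nnegrE ?mulr_ge0 ?nm_ge0.
Qed.

End HilbertModules.

(** * Geometrically convergent sequences *)

Section Completeness.
Context {R : realType} (V : completeNormedModType R[i]).
Implicit Types (x y z : V) (c d e q : R).

Lemma geometric_dist (x : nat -> V) c q : 0 <= q -> q < 1 ->
  (forall m, nm (x m.+1 - x m) <= c * q ^+ m) ->
  forall m k, nm (x (m + k)%N - x m) <= c * q ^+ m / (1 - q).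
Proof.
move=> q0 q1 xq m k; have q1' : 0 < 1 - q by rewrite subr_gt0.
have c0 : 0 <= c by have := xq 0%N; rewrite mulr1; apply: le_trans; exact: nm_ge0.
suff : nm (x (m + k)%N - x m) <= c * (q ^+ m - q ^+ (m + k)) / (1 - q).
  move/le_trans; apply; rewrite ler_wpM2r ?invr_ge0 ?(ltW q1') //.
  by rewrite ler_wpM2l // gerBl exprn_ge0.
elim: k => [|k IH]; first by rewrite addn0 !subrr nm0 mulr0 mul0r.
have -> : x (m + k.+1)%N - x m = (x (m + k).+1 - x (m + k)%N) + (x (m + k)%N - x m).
  by rewrite addnS; zmod.
apply: le_trans (nm_triangle _ _) (le_trans (lerD (xq _) IH) _).
rewrite addnS exprS le_eqVlt; apply/orP; left; apply/eqP.
by field; rewrite gt_eqF.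
Qed.

Lemma geometric_cvg (x : nat -> V) c q : 0 <= q -> q < 1 ->
  (forall m, nm (x m.+1 - x m) <= c * q ^+ m) ->
  exists l, (forall F : set V, closed F -> (forall m, F (x m)) -> F l)
    /\ forall m, nm (l - x m) <= c * q ^+ m / (1 - q).
Proof.
move=> q0 q1 xq; have q1' : 0 < 1 - q by rewrite subr_gt0.
have dx := geometric_dist q0 q1 xq.
have c0 : 0 <= c by have := xq 0%N; rewrite mulr1; apply: le_trans; exact: nm_ge0.
have small e : 0 < e -> exists m, c * q ^+ m / (1 - q) < e.
  move=> e0; have d0 : 0 < e * (1 - q) / (c + 1) / 2 by rewrite !divr_gt0 ?mulr_gt0 // ltr_wpDl.
  have [m qm] := pow_small q0 q1 d0; exists m.
  rewrite ltr_pdivrMr //.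
  have c1 : 0 < c + 1 by rewrite ltr_wpDl.
  have qm' : (c + 1) * q ^+ m <= e * (1 - q) / 2.
    by rewrite mulrC -ler_pdivlMr //; apply: le_trans qm _; rewrite mulrAC.
  have ee : 0 < e * (1 - q) by rewrite mulr_gt0.
  have := exprn_ge0 m q0; nra.
have cx : cvg (x @ \oo).
  apply: cauchy_cvg; apply: cauchy_exP => e e0.
  have er : (complex.Re e)%:C%C = e by rewrite RRe_real // gtr0_real.
  have e0' : 0 < complex.Re e by rewrite -ltcR er.
  have [m me] := small _ e0'; exists (x m); exists m => // k /= mk.
  rewrite -ball_normE /= distrC -er -nmE ltcR.
  by apply: le_lt_trans me; rewrite -(subnKC mk).
exists (lim (x @ \oo)); split=> [F cF Fx|m].
  by apply: (closed_cvg _ cF) cx; exact: nearW.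
apply/ler_addgt0Pr => e e0.
have e0' : 0 < e%:C%C :> R[i] by rewrite ltcR.
have /cvgrPdist_lt /(_ _ e0') [k _ kP] := cx.
have := kP (m + k)%N (leq_addl _ _); rewrite /= -nmE ltcR => lk.
have -> : lim (x @ \oo) - x m
  = (lim (x @ \oo) - x (m + k)%N) + (x (m + k)%N - x m) by zmod.
apply: le_trans (nm_triangle _ _) _.
by rewrite [leRHS]addrC; apply: lerD; [exact: ltW | exact: dx].
Qed.

End Completeness.

(** * Weakly bounded sets and boundedness of adjointable operators *)

Section UniformBoundedness.
Context {R : realType} {A : cstarAlgType R}.
Implicit Types (H K : hilbertModType A) (c d e r t : R).

Definition submodule H (F : set H) :=
  [/\ F 0, forall x y, F x -> F y -> F (x + y)
    & forall (k : R[i]) x, F x -> F (k *: x)].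

Lemma submoduleB H (F : set H) x y : submodule F -> F x -> F y -> F (x - y).
Proof.
by move=> [_ FD FZ] Fx Fy; apply: FD => //; rewrite -scaleN1r; exact: FZ.
Qed.

(** Uniform boundedness for the functionals [<u, _>], by a gliding hump instead
    of Baire's theorem: the limit of steps of length [3^-m] in the directions
    [u m], with signs chosen so that each step counts, is a point of [F] where
    the functionals are unbounded. The argument takes place in a closed
    submodule because it is needed on the range of an operator. *)
Lemma weakly_bounded H (F U : set H) : closed F -> submodule F ->
  (forall u, U u -> F u) ->
  (forall z, F z -> exists c, forall u, U u -> nm (ip u z : A) <= c) ->
  exists c, forall u, U u -> nm u <= c.
Proof.
move=> cF sF UF wU; apply: contrapT => unb.
have [u uP] : exists u : nat -> H, forall m,
    U (u m) /\ m%:R * 3 ^+ m < nm (u m).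
  suff /boolp.choice[u uP] : forall m, exists v, U v /\ m%:R * 3 ^+ m < nm v.
    by exists u.
  move=> m.
  apply: contrapT => nu; apply: unb; exists (m%:R * 3 ^+ m) => v Uv.
  by rewrite leNgt; apply/negP => uv; apply: nu; exists v.
(* Later steps move the point by at most r m / 2, half of the gain of step m. *)
pose r m : R := 3^-1 ^+ m.
have r0 m : 0 < r m by rewrite exprn_gt0 // invr_gt0.
have up m : 0 < nm (u m).
  by apply: le_lt_trans (uP m).2; rewrite mulr_ge0 // exprn_ge0.
pose v m := (r m / nm (u m))%:C%C *: u m.
have nv m : nm (v m) = r m.
  by rewrite nmZp ?divfK ?gt_eqF // divr_ge0 // ltW.
pose step m y := if r m * nm (u m) <= nm (ip (u m) (y + v m) : A)
                 then y + v m else y - v m.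
have step_big m y : r m * nm (u m) <= nm (ip (u m) (step m y) : A).
  rewrite /step; case: ifP => // /negbT; rewrite -ltNge => small.
  have : nm (ip (u m) (v m) : A) = r m * nm (u m).
    rewrite ipZr nmZp ?nm_ip; last by rewrite divr_ge0 // ltW.
    by rewrite expr2 mulrA divfK ?gt_eqF.
  have -> : ip (u m) (v m) = (2^-1 : R)%:C%C
      *: (ip (u m) (y + v m) - ip (u m) (y - v m) : A).
    rewrite -[LHS]half_double; congr (_ *: _).
    by rewrite ipBr ipDr; zmod.
  have := nmB (ip (u m) (y + v m) : A) (ip (u m) (y - v m)).
  rewrite nmZp ?invr_ge0 //; lra.
pose x := fix x m := if m is m'.+1 then step m' (x m') else 0.
have xS m : x m.+1 = step m (x m) by [].
have dx m : nm (x m.+1 - x m) <= 1 * 3^-1 ^+ m.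
  rewrite mul1r -/(r m) -nv xS /step.
  by case: ifP => _; rewrite addrAC subrr add0r ?nmN.
have Fx m : F (x m).
  have [F0 FD FZ] := sF; elim: m => [//|m IH]; rewrite xS /step.
  have Fv : F (v m) by apply: FZ; apply: UF; exact: (uP m).1.
  by case: ifP => _; [exact: FD | exact: submoduleB].
have [] := geometric_cvg _ _ dx; rewrite ?invr_ge0 ?invf_lt1 ?ltr1n //.
move=> l [Fl dl]; have [c cP] := wU _ (Fl _ cF Fx).
pose m := Num.bound (2 * c).
have mc : 2 * c < m%:R by exact: unstable.ltr_bound.
have big := step_big m (x m); rewrite -xS in big.
have := cP _ (uP m).1.
have -> : ip (u m) l = ip (u m) (x m.+1) + ip (u m) (l - x m.+1) :> A.
  by rewrite -ipDr addrC subrK.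
have lb (a b : A) : nm a - nm b <= nm (a + b).
  rewrite lerBlDr; apply: le_trans (nmB _ _).
  by rewrite addrK.
move/(le_trans (lb _ _)).
have cs := cauchy_schwarz (u m) (l - x m.+1).
have := dl m.+1; rewrite mul1r exprS -/(r m) => dlm.
have half : nm (l - x m.+1) <= r m / 2.
  by apply: le_trans dlm _; rewrite le_eqVlt; apply/orP; left; apply/eqP; field.
have cs2 : nm (ip (u m) (l - x m.+1) : A) <= nm (u m) * (r m / 2).
  by apply: le_trans cs _; rewrite ler_wpM2l // ltW.
have := (uP m).2; rewrite -ltr_pdivlMr ?exprn_gt0 // -exprVn -/(r m).
nra.
Qed.

(** The image of the unit ball is weakly bounded, since
    [<T x, z> = <x, T^* z>]. *)
Lemma adjointable_bounded H K (T : adjointable H K) :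
  exists2 c, 0 <= c & forall x, nm (T x) <= c * nm x.
Proof.
have [c cP] : exists c, forall u, (exists2 x, nm x <= 1 & u = T x) -> nm u <= c.
  apply: (@weakly_bounded _ setT) => //.
  move=> z _; exists (nm (adj T z)) => _ [x x1 ->]; rewrite aadjE.
  by apply: le_trans (cauchy_schwarz _ _) _; rewrite ler_piMl ?nm_ge0.
have c0 : 0 <= c by apply: le_trans (cP 0 _); rewrite ?nm_ge0 //; exists 0; rewrite ?nm0 ?a0.
exists c => // x; have [->|x0] := eqVneq x 0; first by rewrite a0 !nm0 mulr0.
have xp := nm_gt0 x0.
rewrite -ler_pdivrMr // mulrC -nmZp ?invr_ge0 ?nm_ge0 // -aZ; apply: cP.
by exists ((nm x)^-1%:C%C *: x) => //; rewrite nmZp ?invr_ge0 ?nm_ge0 // mulVf ?gt_eqF.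
Qed.

End UniformBoundedness.

(** * Surjectivity of coercive operators *)

Lemma geometric_le0 (R : realType) (a c q : R) : 0 <= q -> q < 1 ->
  (forall m, a <= c * q ^+ m) -> a <= 0.
Proof.
move=> q0 q1 aq; apply/ler_addgt0Pr => e e0; rewrite add0r.
have c0 : 0 < `|c| + 1 by rewrite ltr_wpDl.
have [m qm] := pow_small q0 q1 (divr_gt0 e0 c0).
apply: le_trans (aq m) _; apply: le_trans (ler_norm _) _.
rewrite normrM (ger0_norm (exprn_ge0 m q0)).
apply: le_trans (ler_wpM2l (normr_ge0 c) qm) _.
by rewrite mulrCA ler_piMr ?(ltW e0) // ler_pdivrMr // mul1r lerDl.
Qed.

Section Scaling.
Context {R : realType} {A : cstarAlgType R} (H : hermModType A).

Definition ascale (t : R) : adjointable H H.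
Proof.
apply: (@Adjointable _ _ _ _ (fun x => t%:C%C *: x) (fun x => t%:C%C *: x)) => x y.
by rewrite ipZl ipZr conjR.
Defined.
End Scaling.

Section Surjectivity.
Context {R : realType} {A : cstarAlgType R} (H : hilbertModType A) (F : set H).
Hypotheses (cF : closed F) (sF : submodule F).
Implicit Types (S E P : adjointable H H) (d t : R).

Definition onto S := forall w, F w -> exists2 x, F x & S x = w.

(** To solve [S x + E x = w], iterate [x |-> S^-1 (w - E x)], which contracts
    distances by the factor 1/2. *)
Lemma perturb_onto S E d : 0 < d -> (forall x, F x -> F (E x)) ->
  (forall x, F x -> d * nm x <= nm (S x)) ->
  (forall x, nm (E x) <= d / 2 * nm x) -> onto S -> onto (S + E).
Proof.
move=> d0 FE Sd Ed oS w Fw.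
have [F0 _ _] := sF.
have [g gP] : exists g : H -> H, forall v, F v -> F (g v) /\ S (g v) = v.
  suff /boolp.choice[g gP] : forall v, exists y, F v -> F y /\ S y = v by exists g.
  move=> v; have [Fv|nFv] := pselect (F v); last by exists 0.
  by have [y Fy Sy] := oS v Fv; exists y.
pose x := fix x m := if m is m'.+1 then g (w - E (x m')) else 0.
have xS m : x m.+1 = g (w - E (x m)) by [].
have Fx m : F (x m).
  elim: m => [//|m IH]; rewrite xS; apply: (gP _ _).1.
  by apply: submoduleB => //; exact: FE.
have Sx m : S (x m.+1) = w - E (x m).
  by apply: (gP _ _).2; apply: submoduleB => //; exact: FE.
have q0 : 0 <= 2^-1 :> R by rewrite invr_ge0.
have q1 : 2^-1 < 1 :> R by rewrite invf_lt1 ?ltr1n.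
have dx m : nm (x m.+1 - x m) <= nm (x 1%N) * 2^-1 ^+ m.
  elim: m => [|m IH]; first by rewrite subr0 mulr1.
  have := Sd _ (submoduleB sF (Fx m.+2) (Fx m.+1)).
  rewrite aB !Sx.
  have -> : w - E (x m.+1) - (w - E (x m)) = - E (x m.+1 - x m).
    by rewrite aB; zmod.
  rewrite nmN exprSr mulrA => /le_trans /(_ (Ed _)) h.
  rewrite -(ler_pM2l d0); apply: le_trans h _; nra.
have [l [Fl dl]] := geometric_cvg q0 q1 dx.
exists l; first exact: Fl.
have [k k0 Sk] := adjointable_bounded S.
apply/eqP; rewrite -subr_eq0; apply/eqP/nm_eq0/le_anti.
rewrite nm_ge0 andbT.
apply: (@geometric_le0 _ _ ((k + d / 2) * (nm (x 1%N) / (1 - 2^-1))) 2^-1) => // m.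
have -> : (S + E) l - w = S (l - x m.+1) + E (l - x m).
  by rewrite !aB Sx; rewrite -[(S + E) l]/(S l + E l); zmod.
apply: le_trans (nm_triangle _ _) (le_trans (lerD (Sk _) (Ed _)) _).
have xm := dl m; have := dl m.+1; rewrite exprS.
set N := nm (x 1%N); have N0 : 0 <= N := nm_ge0 _.
have qm : 0 <= 2^-1 ^+ m :> R by exact: exprn_ge0.
set Q := 2^-1 ^+ m in qm xm * => xm1.
have h1 : nm (l - x m.+1) <= N / (1 - 2^-1) * Q.
  apply: le_trans xm1 _; rewrite mulrAC ler_wpM2l // ?divr_ge0 ?subr_ge0 ?(ltW q1) //.
  by rewrite ler_piMl // ltW.
have h2 : nm (l - x m) <= N / (1 - 2^-1) * Q.
  by apply: le_trans xm _; rewrite mulrAC.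
rewrite -[leRHS]mulrA [leRHS]mulrDl; apply: lerD; apply: ler_wpM2l => //.
by rewrite divr_ge0 // ltW.
Qed.

(** Method of continuity: [P + t] is onto for large [t], where [P] is a small
    perturbation of [t], and this persists when [t] is lowered by steps of
    length at most [d / 2], down to 0. *)
Lemma onto_of_coercive P d : 0 < d -> (forall x, F x -> F (P x)) ->
  (forall t x, 0 <= t -> F x -> d * nm x <= nm ((P + ascale H t) x)) -> onto P.
Proof.
move=> d0 FP Pd; have [c c0 Pc] := adjointable_bounded P.
have [F0 FD FZ] := sF.
have start : onto (P + ascale H (2 * c + 1)).
  have t0 : 0 < 2 * c + 1 by rewrite ltr_wpDl // mulr_ge0.
  rewrite addrC; apply: (perturb_onto (d := 2 * c + 1)) => //.
  - by move=> x _; rewrite /= nmZp // ltW.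
  - by move=> x; apply: le_trans (Pc x) _; have := nm_ge0 x; nra.
  move=> w Fw; exists ((2 * c + 1)^-1%:C%C *: w); first exact: FZ.
  by rewrite /= scalerA -rmorphM divff ?gt_eqF // rmorph1 scale1r.
have down t s : 0 <= t -> `|s| <= d / 2 -> onto (P + ascale H t) ->
    onto (P + ascale H (t + s)).
  move=> t0 sd oPt.
  have -> : P + ascale H (t + s) = (P + ascale H t) + ascale H s.
    by apply: adjointable_ext => x /=; rewrite rmorphD scalerDl addrA.
  apply: (perturb_onto (d := d)) => // [x Fx|x Fx|x].
  - exact: FZ.
  - exact: Pd.
  - by rewrite /= nmZR ler_wpM2r ?nm_ge0.
suff main m t : 0 <= t -> t <= m%:R * (d / 2) -> onto (P + ascale H t) -> onto P.
  have t0 : 0 <= 2 * c + 1 by rewrite addr_ge0 // mulr_ge0.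
  apply: (main (Num.bound ((2 * c + 1) / (d / 2))) _ t0 _ start).
  rewrite -ler_pdivrMr ?divr_gt0 //; exact/ltW/unstable.ltr_bound.
elim: m t => [|m IH] t t0 tm oPt.
  have {tm} t00 : t = 0 by apply: le_anti; rewrite t0 andbT; rewrite mul0r in tm.
  move=> w /oPt [x Fx]; rewrite t00 => <-; exists x => //.
  by rewrite /= rmorph0 scale0r addr0.
have [td|dt] := leP t (d / 2).
  apply: (IH 0) => //; first by rewrite mulr_ge0 // divr_ge0 // ltW.
  by rewrite -(subrr t); apply: down => //; rewrite normrN ger0_norm.
apply: (IH (t - d / 2)); first by rewrite subr_ge0 ltW.
  by move: tm; rewrite -natr1; lra.
by apply: down => //; rewrite normrN ger0_norm // divr_ge0 // ltW.
Qed.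

End Surjectivity.

(** * Gram operators and operators with closed range *)

Section Invertibility.
Context {R : realType} {A : cstarAlgType R}.

Lemma ainvP (H : hermModType A) (T : adjointable H H) :
  invertible T -> is_inverse T (ainv T).
Proof. by move=> iT; exact: (xgetPex 0 iT). Qed.

Lemma selfadjoint_invertible (H : hermModType A) (T : adjointable H H) :
  adj T = T -> (forall x, T x = 0 -> x = 0) -> (forall w, exists x, T x = w) ->
  invertible T.
Proof.
move=> Ts T0 /boolp.choice[S TS].
have ST x : S (T x) = x.
  by apply/eqP; rewrite -subr_eq0; apply/eqP/T0; rewrite aB TS subrr.
have SP x y : ip (S x) y = ip x (S y) :> A.
  by rewrite -{1}[y]TS aadjPr Ts TS.
exists (Adjointable SP).
by split; apply: adjointable_ext => x /=; [exact: ST | exact: TS].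
Qed.

(** Direct sums of Hilbert modules carry an inner product but no norm here;
    this property, stable under direct sums, replaces boundedness of the
    operators defined on them. *)
Definition bounded_domain (K : hermModType A) := forall (H : hilbertModType A)
  (G : adjointable K H), exists2 c, 0 <= c & forall u, nm (G u) ^+ 2 <= c * nm (ip u u : A).

Lemma hilbert_bounded_domain (K : hilbertModType A) : bounded_domain K.
Proof.
move=> H G; have [c c0 Gc] := adjointable_bounded G.
exists (c ^+ 2); first exact: exprn_ge0.
by move=> u; rewrite nm_ip -exprMn ler_pXn2r ?nnegrE ?nm_ge0 ?mulr_ge0 ?nm_ge0.
Qed.

Definition ainl (H K : hermModType A) : adjointable H (H * K)%type :=
  acol (aid H) 0.
Definition ainr (H K : hermModType A) : adjointable K (H * K)%type :=
  acol 0 (aid K).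

Lemma prod_bounded_domain (K1 K2 : hermModType A) :
  ip_positive K1 -> ip_positive K2 ->
  bounded_domain K1 -> bounded_domain K2 -> bounded_domain (K1 * K2)%type.
Proof.
move=> p1 p2 b1 b2 H G.
have [c c0 cP] := b1 _ (G \oL ainl K1 K2); have [d d0 dP] := b2 _ (G \oL ainr K1 K2).
exists (2 * (c + d)); first by rewrite mulr_ge0 // addr_ge0.
case=> u v; have -> : G (u, v) = (G \oL ainl K1 K2) u + (G \oL ainr K1 K2) v.
  by rewrite /= -aD; congr (G _); congr pair; rewrite /= ?addr0 ?add0r.
set x := _ u; set y := _ v.
have uu : nm (ip u u : A) <= nm (ip (u, v) (u, v) : A) by exact: le_nm_posA.
have vv : nm (ip v v : A) <= nm (ip (u, v) (u, v) : A).
  rewrite -[ip (u, v) _]/(ip u u + ip v v : A) addrC; exact: le_nm_posA.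
have := cP u; have := dP v; rewrite -/x -/y => yd xc.
have xy := nm_triangle x y; have xy0 := nm_ge0 (x + y).
have x0 := nm_ge0 x; have y0 := nm_ge0 y.
have s : nm (x + y) ^+ 2 <= 2 * (nm x ^+ 2 + nm y ^+ 2).
  have : nm (x + y) ^+ 2 <= (nm x + nm y) ^+ 2.
    by rewrite ler_pXn2r ?nnegrE ?addr_ge0.
  by have := sqr_ge0 (nm x - nm y); rewrite !expr2; nra.
apply: le_trans s _; rewrite -mulrA ler_wpM2l // mulrDl.
apply: lerD; [apply: le_trans xc _ | apply: le_trans yd _]; exact: ler_wpM2l.
Qed.

(** As [x = G (W x)], the form [<W x, W x>] dominates a multiple of [|x|^2], so
    by monotonicity of the norm on positive elements and the Cauchy-Schwarz
    inequality [W^* W + t] is bounded below uniformly in [t >= 0]. *)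
Lemma gram_invertible (H : hilbertModType A) (K : hermModType A)
    (W : adjointable H K) (G : adjointable K H) :
  ip_positive K -> bounded_domain K -> G \oL W = aid H ->
  invertible (adj W \oL W).
Proof.
move=> pK bK GW; have [c c0 cP] := bK _ G.
pose P := adj W \oL W; pose d := (c + 1)^-1.
have c1 : 0 < c + 1 by rewrite ltr_wpDl.
have d0 : 0 < d by rewrite invr_gt0.
have PE x : ip x (P x) = ip (W x) (W x) :> A by rewrite -aadjE.
have Wd x : d * nm x ^+ 2 <= nm (ip (W x) (W x) : A).
  have -> : nm x = nm (G (W x)) by have /(congr1 (fun S : adjointable H H => S x)) /= -> := GW.
  rewrite mulrC ler_pdivrMr //; apply: le_trans (cP _) _.
  by rewrite mulrC ler_wpM2l ?nm_ge0 // lerDl.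
have coercive t x : 0 <= t -> d * nm x <= nm ((P + ascale H t) x).
  move=> t0; have [->|x0] := eqVneq x 0; first by rewrite nm0 mulr0 nm_ge0.
  have xp := nm_gt0 x0.
  rewrite -(ler_pM2l xp) mulrCA -expr2.
  apply: le_trans (cauchy_schwarz _ _); apply: le_trans (Wd x) _.
  rewrite -[(P + _) x]/(P x + t%:C%C *: x) ipDr PE ipZr.
  by apply: le_nm_posA; [exact: pK | apply/posAZ/hilbert_ip_positive].
have sT : submodule (setT : set H) by [].
apply: selfadjoint_invertible.
- exact: adjointable_ext.
- move=> x Px; apply: nm_eq0; apply: le_anti; rewrite nm_ge0 andbT.
  have := coercive 0 x (lexx 0).
  rewrite -[(P + _) x]/(P x + 0%:C%C *: x) [P x]Px rmorph0 scale0r addr0 nm0.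
  by rewrite pmulr_rle0.
- move=> w; have [] := onto_of_coercive (@closedT _) sT d0 (P := P) _ _ (w := w) => //.
  + by move=> t x t0 _; exact: coercive.
  + by move=> x _ <-; exists x.
Qed.

(** On the closed submodule [F = range T], [T^*] is bounded below: the [u] in [F]
    with [|T^* u| <= 1] are weakly bounded, since [<u, T x> = <T^* u, x>]. Hence
    [T T^*] maps [F] onto itself, and every [w] is the sum of some [T T^* z]
    with [z] in [F] and of an element of the kernel of [T^*]. The inverse is
    [w |-> T^* z], with adjoint [x |-> z (T x)]. *)
Lemma closed_range_inner_inverse (H K : hilbertModType A) (T : adjointable H K) :
  closed (range T) -> exists G : adjointable K H, T \oL G \oL T = T.
Proof.
move=> cT; pose F := range T; pose P := T \oL adj T.
have sF : submodule F.
  split; first by exists 0 => //; rewrite a0.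
    by move=> _ _ [x _ <-] [y _ <-]; exists (x + y) => //; rewrite aD.
  by move=> k _ [x _ <-]; exists (k *: x) => //; rewrite aZ.
have [c cP] : exists c, forall u, (F u /\ nm (adj T u) <= 1) -> nm u <= c.
  apply: (weakly_bounded cT sF) => [u []//|_ [x _ <-]].
  exists (nm x) => u [_ u1]; rewrite aadjPr.
  by apply: le_trans (cauchy_schwarz _ _) _; rewrite ler_piMl ?nm_ge0.
have c0 : 0 <= c.
  apply: le_trans (cP 0 _); rewrite ?nm_ge0 //.
  by split; [case: sF | rewrite a0 nm0].
have lower y : F y -> nm y <= c * nm (adj T y).
  move=> Fy; apply/ler_addgt0Pr => e e0; pose s := nm (adj T y) + e / (c + 1).
  have c1 : 0 < c + 1 by rewrite ltr_wpDl.
  have s0 : 0 < s by rewrite ltr_wpDl ?nm_ge0 // divr_gt0.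
  have si0 : 0 <= s^-1 by rewrite invr_ge0 ltW.
  have : nm (s^-1%:C%C *: y) <= c.
    apply: cP; split; first by case: sF => _ _; apply.
    by rewrite aZ nmZp // mulrC ler_pdivrMr // mul1r lerDl divr_ge0 // ltW.
  rewrite nmZp // mulrC ler_pdivrMr // => /le_trans; apply.
  rewrite mulrDr lerD2l mulrCA ler_piMr ?(ltW e0) //.
  by rewrite ler_pdivrMr // mul1r lerDl.
pose d := (c * c + 1)^-1.
have c1 : 0 < c * c + 1 by rewrite ltr_wpDl // mulr_ge0.
have d0 : 0 < d by rewrite invr_gt0.
have coercive t x : 0 <= t -> F x -> d * nm x <= nm ((P + ascale K t) x).
  move=> t0 Fx; have [->|x0] := eqVneq x 0; first by rewrite nm0 mulr0 nm_ge0.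
  have xp := nm_gt0 x0.
  rewrite -(ler_pM2l xp) mulrCA -expr2.
  apply: le_trans (cauchy_schwarz _ _).
  apply: (@le_trans _ _ (nm (ip (adj T x) (adj T x) : A))).
    rewrite nm_ip mulrC ler_pdivrMr //.
    have := lower _ Fx; have := nm_ge0 (adj T x); rewrite !expr2; nra.
  rewrite -[(P + _) x]/(T (adj T x) + t%:C%C *: x) ipDr (aadjPr T) ipZr.
  by apply: le_nm_posA; [exact: hilbert_ip_positive | apply/posAZ/hilbert_ip_positive].
have oP : onto F P.
  by apply: (onto_of_coercive cT sF d0) => // x _; exists (adj T x).
(* <T^* u, T^* u> = <u, T T^* u>. *)
have kerTT u : T (adj T u) = 0 -> adj T u = 0.
  by move=> Tu; apply: (ip_def (s := H)); rewrite -aadjPr Tu ip0r.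
have [z zP] : exists z : K -> K, forall w, F (z w) /\ adj T (w - P (z w)) = 0.
  suff /boolp.choice[z zP] : forall w, exists y, F y /\ adj T (w - P y) = 0 by exists z.
  move=> w; have [|y1 Fy1 Py1] := oP (P w); first by exists (adj T w).
  have [y Fy Py] := oP y1 Fy1; exists y; split=> //.
  apply: kerTT; rewrite aB [P y]Py aB.
  by rewrite -[T (adj T w)]/(P w) -Py1 subrr.
have FP y : F (P y) by exists (adj T y).
have Pz x : P (z (T x)) = T x.
  have [_ zx] := zP (T x); apply/eqP; rewrite eq_sym -subr_eq0; apply/eqP/nm_eq0.
  apply: le_anti; rewrite nm_ge0 andbT.
  have := lower (T x - P (z (T x))); rewrite zx nm0 mulr0; apply.
  by apply: submoduleB => //; exists x.
have GP w x : ip (adj T (z w)) x = ip w (z (T x)) :> A.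
  have [[a _ za] _] := zP (T x).
  have : ip (w - P (z w)) (z (T x)) = 0 :> A.
    by rewrite -za aadjPr (zP w).2 ip0l.
  rewrite ipBl => /eqP; rewrite subr_eq0 => /eqP->.
  by rewrite -aadjPr -{1}Pz -[P (z w)]/(T _) aadjE -[P _]/(T _) aadjPr.
exists (Adjointable GP); apply: adjointable_ext => x.
exact: Pz.
Qed.
End Invertibility.

(** * Weighted Moore-Penrose inverses *)

Section OperatorAlgebra.
Context {R : realType} {A : cstarAlgType R}.
Implicit Types H K G : hermModType A.

Lemma ext_eq H K (S T : adjointable H K) : S = T -> S =1 T.
Proof. by move=> ->. Qed.

Lemma adj_comp H K G (S : adjointable K G) (T : adjointable H K) :
  adj (S \oL T) = adj T \oL adj S.
Proof. exact: adjointable_ext. Qed.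

Lemma inverse_uniq H (T S S' : adjointable H H) :
  is_inverse T S -> is_inverse T S' -> S = S'.
Proof.
move=> [ST _] [_ TS']; apply: adjointable_ext => x.
have TS'x : T (S' x) = x by exact: ext_eq TS' x.
by rewrite -[in LHS]TS'x; exact: ext_eq ST (S' x).
Qed.

Lemma inverse_adj H (T S : adjointable H H) :
  is_inverse T S -> is_inverse (adj T) (adj S).
Proof.
by move=> [ST TS]; split; rewrite -adj_comp ?ST ?TS; exact: adjointable_ext.
Qed.

Lemma ainv_adj H (T : adjointable H H) :
  adj T = T -> invertible T -> adj (ainv T) = ainv T.
Proof.
move=> Ts iT; apply: (inverse_uniq (T := T)); last exact: ainvP.
by rewrite -{1}Ts; apply/inverse_adj/ainvP.
Qed.

Lemma ainvK H (T : adjointable H H) : invertible T -> forall x, ainv T (T x) = x.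
Proof. by move=> /ainvP[ST _]; exact: ext_eq ST. Qed.

Lemma ainvKV H (T : adjointable H H) : invertible T -> forall x, T (ainv T x) = x.
Proof. by move=> /ainvP[_ TS]; exact: ext_eq TS. Qed.

(** Passing to adjoints in [M T X] and [M T Y] gives [T X = T Y]; likewise
    [X T = Y T], and then [X = X T X = X T Y = Y T Y = Y]. *)
Lemma is_wMP_uniq H K M N (T : adjointable H K) X Y :
  adj M = M -> invertible M -> adj N = N -> invertible N ->
  is_wMP M N T X -> is_wMP M N T Y -> X = Y.
Proof.
move=> Ms iM Ns iN [TXT XTX MTX NXT] [TYT YTY MTY NYT].
have a_X y : adj X (adj T (M y)) = M (T (X y)).
  by rewrite -{1}Ms; exact: ext_eq MTX y.
have a_Y y : adj Y (adj T (M y)) = M (T (Y y)).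
  by rewrite -{1}Ms; exact: ext_eq MTY y.
have b_X y : adj T (adj X (N y)) = N (X (T y)).
  by rewrite -{1}Ns; exact: ext_eq NXT y.
have b_Y y : adj T (adj Y (N y)) = N (Y (T y)).
  by rewrite -{1}Ns; exact: ext_eq NYT y.
have tX y : T (X (T y)) = T y by exact: ext_eq TXT y.
have tY y : T (Y (T y)) = T y by exact: ext_eq TYT y.
have atX y : adj T (adj X (adj T y)) = adj T y.
  by rewrite -[RHS](ext_eq (congr1 (@adj _ _ _ _) TXT)).
have atY y : adj T (adj Y (adj T y)) = adj T y.
  by rewrite -[RHS](ext_eq (congr1 (@adj _ _ _ _) TYT)).
have TXY y : T (X y) = T (Y y).
  rewrite -[LHS](ainvK iM) -[RHS](ainvK iM); congr (ainv M _).
  by rewrite -a_X -[in LHS](atY (M y)) a_Y a_X tX.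
have XTY y : X (T y) = Y (T y).
  rewrite -[LHS](ainvK iN) -[RHS](ainvK iN); congr (ainv N _).
  by rewrite -b_Y -[in LHS](tY y) -(b_X (Y (T y))) -b_Y atX.
apply: adjointable_ext => y.
by rewrite -[LHS](ext_eq XTX) -[RHS](ext_eq YTY) /= XTY TXY.
Qed.

Lemma wMPP H K M N (T : adjointable H K) :
  (exists X, is_wMP M N T X) -> is_wMP M N T (wMP M N T).
Proof. by move=> eX; exact: (xgetPex 0 eX). Qed.

End OperatorAlgebra.

Section Existence.
Context {R : realType} {A : cstarAlgType R}.
Implicit Types H K : hilbertModType A.

(** A positive definite operator is [S^* S] with [S] an endomorphism. A corner
    or a compression of such an operator is a Gram operator through another
    module, and no square root is needed if that is allowed. *)
Definition gram_definite (H : hermModType A) (M : adjointable H H) :=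
  invertible M /\ exists (K : hermModType A) (Y : adjointable H K),
    [/\ ip_positive K, bounded_domain K & M = adj Y \oL Y].

Lemma gram_definite_adj (H : hermModType A) (M : adjointable H H) :
  gram_definite M -> adj M = M.
Proof. by move=> [_ [K [Y [_ _ ->]]]]; exact: adjointable_ext. Qed.

Lemma positive_definite_gram H (M : adjointable H H) :
  positive_definite M -> gram_definite M.
Proof.
move=> [[Y MY] iM]; split=> //; exists H, Y; split=> //.
  exact: hilbert_ip_positive.
exact: hilbert_bounded_domain.
Qed.

Lemma gram_definite_compression H (K : hermModType A) (N : adjointable K K)
    (X : adjointable H K) (G : adjointable K H) :
  gram_definite N -> G \oL X = aid H -> gram_definite (adj X \oL N \oL X).
Proof.
move=> [iN [K' [Z [pK bK NZ]]]] GX.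
have -> : adj X \oL N \oL X = adj (Z \oL X) \oL (Z \oL X).
  by rewrite NZ; exact: adjointable_ext.
split; last by exists K', (Z \oL X).
apply: (gram_invertible (G := G \oL ainv N \oL adj Z)) => //.
have ZN u : adj Z (Z u) = N u by rewrite NZ.
apply: adjointable_ext => x; rewrite -[RHS](ext_eq GX x).
by rewrite -[LHS]/(G (ainv N (adj Z (Z (X x))))) ZN ainvK.
Qed.

(** The right-hand side is [e^* M1 e + (1 - e)^* M2 (1 - e)]. With
    [Mi = Yi^* Yi] it is the Gram operator of the column of [Y1 e] and
    [Y2 (1 - e)], whose left inverse is the row of [e M1^-1 Y1^*] and
    [(1 - e) M2^-1 Y2^*]. *)
Lemma diagonal_invertible H (M1 M2 e : adjointable H H) :
  gram_definite M1 -> gram_definite M2 -> (forall x, e (e x) = e x) ->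
  exists2 Phi : adjointable H H, invertible Phi & forall x,
    Phi x = adj e (M1 (e x)) + (M2 (x - e x) - adj e (M2 (x - e x))).
Proof.
move=> [i1 [K1 [Y1 [p1 b1 M1Y]]]] [i2 [K2 [Y2 [p2 b2 M2Y]]]] ee.
have YM1 x : adj Y1 (Y1 x) = M1 x by rewrite M1Y.
have YM2 x : adj Y2 (Y2 x) = M2 x by rewrite M2Y.
pose W := acol (Y1 \oL e) (Y2 \oL (aid H - e)).
pose G := arow (e \oL ainv M1 \oL adj Y1) ((aid H - e) \oL ainv M2 \oL adj Y2).
have GW : G \oL W = aid H.
  apply: adjointable_ext => x.
  rewrite -[LHS]/(e (ainv M1 (adj Y1 (Y1 (e x)))) +
    (aid H - e) (ainv M2 (adj Y2 (Y2 (x - e x))))).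
  rewrite YM1 YM2 !ainvK // -[(aid H - e) _]/(x - e x - e (x - e x)) aB !ee.
  by zmod.
exists (adj W \oL W).
  exact: gram_invertible (prod_ip_positive p1 p2) (prod_bounded_domain p1 p2 b1 b2) GW.
by move=> x; rewrite -YM1 -!YM2.
Qed.

(** The projection onto the range of [e] that is orthogonal for [<_, M _>] is
    [Phi^-1 e^* M], where [Phi = e^* M e + (1 - e)^* M (1 - e)]: indeed
    [Phi e = e^* M e = e^* Phi]. *)
Lemma orthogonal_projection K (M e : adjointable K K) :
  gram_definite M -> (forall x, e (e x) = e x) ->
  exists P : adjointable K K, [/\ forall x, e (P x) = P x,
    forall x, P (e x) = e x & adj (M \oL P) = M \oL P].
Proof.
move=> gM ee; have Ms := gram_definite_adj gM.
have [Phi iPhi PhiE] := diagonal_invertible gM gM ee.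
pose Psi := ainv Phi.
have PsiPhi x : Psi (Phi x) = x by exact: ainvK.
have PhiPsi x : Phi (Psi x) = x by exact: ainvKV.
have ae x : adj e (adj e x) = adj e x.
  have aeE : adj (e \oL e) = adj e.
    by congr adj; apply: adjointable_ext => z; rewrite /= ee.
  exact: ext_eq aeE x.
have Phie x : Phi (e x) = adj e (M (e x)).
  by rewrite PhiE !ee subrr a0 a0 subr0 addr0.
have ePhi x : adj e (Phi x) = adj e (M (e x)).
  by rewrite PhiE aD aB !ae subrr addr0.
have ePsi x : Psi (adj e x) = e (Psi x).
  by rewrite -[RHS]PsiPhi Phie -ePhi PhiPsi.
exists (Psi \oL adj e \oL M); split=> [x|x|].
- by rewrite -[(Psi \oL _ \oL _) x]/(Psi (adj e (M x))) -ePsi ae.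
- by rewrite -[RHS]PsiPhi Phie.
have Phis : adj Phi = Phi.
  have -> : Phi = adj e \oL M \oL e + (aid K - adj e) \oL M \oL (aid K - e).
    exact: adjointable_ext.
  apply: adjointable_ext => x.
  by rewrite -[LHS]/(adj e (adj M (e x)) + (adj M (x - e x) - adj e (adj M (x - e x)))) Ms.
have Psis : adj Psi = Psi by exact: ainv_adj.
rewrite !adj_comp Ms Psis adjK; apply: adjointable_ext => x /=.
by rewrite -ePsi.
Qed.

(** An inner inverse [G] gives the idempotents [T G] and [1 - G T]. With [P] the
    [M]-orthogonal projection onto the range of [T] and [1 - F] the
    [N]-orthogonal projection onto its kernel, [F G P] is the weighted inverse. *)
Lemma wMP_exists H K (M : adjointable K K) (N : adjointable H H)
    (T : adjointable H K) :
  gram_definite M -> gram_definite N -> closed (range T) ->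
  exists X, is_wMP M N T X.
Proof.
move=> pM pN /closed_range_inner_inverse [G /ext_eq TGT].
have tgt x : T (G (T x)) = T x := TGT x.
have [|P [eP Pe MP]] := orthogonal_projection (e := T \oL G) pM.
  by move=> x /=; rewrite tgt.
have [|P' [eP' Pe' NP]] := orthogonal_projection (e := aid H - G \oL T) pN.
  move=> x; rewrite -[LHS]/(x - G (T x) - G (T (x - G (T x)))).
  by rewrite aB tgt subrr a0 subr0.
have TP' x : T (P' x) = 0.
  by rewrite -eP' -[T _]/(T (P' x - G (T (P' x)))) aB tgt subrr.
have P'T x : P' (G (T x)) = P' x - (x - G (T x)).
  by rewrite -[x - _]/((aid H - G \oL T) x) -Pe' -aB; congr (P' _) => /=; zmod.
pose F := aid H - P'.
have FE x : F x = x - P' x by [].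
have TF x : T (F x) = T x by rewrite FE aB TP' subr0.
have FGT x : F (G (T x)) = F x by rewrite !FE P'T; zmod.
have PT x : P (T x) = T x by have := Pe (T x); rewrite /= tgt.
have TX x : T (F (G (P x))) = P x by rewrite TF; exact: eP.
have XT x : F (G (P (T x))) = F x by rewrite PT FGT.
have PP x : P (P x) = P x by rewrite -[X in P X = _]eP Pe eP.
exists (F \oL G \oL P); split.
- by apply: adjointable_ext => x /=; rewrite TX PT.
- by apply: adjointable_ext => x /=; rewrite TX PP.
- have -> // : M \oL T \oL (F \oL G \oL P) = M \oL P.
  by apply: adjointable_ext => x /=; rewrite TX.
- have -> : N \oL (F \oL G \oL P) \oL T = N - N \oL P'.
    by apply: adjointable_ext => x; rewrite -[LHS]/(N (F (G (P (T x))))) XT FE aB.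
  have Ns := gram_definite_adj pN.
  apply: adjointable_ext => x.
  by rewrite -[LHS]/(adj N x - adj (N \oL P') x) Ns NP.
Qed.

End Existence.

(** * The inverse of a row operator *)

Section WeightedInverse.
Context {R : realType} {A : cstarAlgType R}.
Implicit Types H K : hermModType A.

(** The Penrose equations pointwise, with the adjoints applied; rewriting with
    equations between values needs no reassociation of composites. *)
Record wMP_spec H K (M : adjointable K K) (N : adjointable H H)
    (T : adjointable H K) (X : adjointable K H) : Prop := WMPSpec {
  wMP_TXT : forall x, T (X (T x)) = T x;
  wMP_XTX : forall y, X (T (X y)) = X y;
  wMP_MTX : forall y, adj X (adj T (M y)) = M (T (X y));
  wMP_NXT : forall x, adj T (adj X (N x)) = N (X (T x)) }.

Lemma is_wMP_spec H K M N (T : adjointable H K) X :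
  adj M = M -> adj N = N -> is_wMP M N T X -> wMP_spec M N T X.
Proof.
move=> Ms Ns [TXT XTX MTX NXT]; split.
- exact: ext_eq TXT.
- exact: ext_eq XTX.
- by move=> y; rewrite -{1}Ms; exact: ext_eq MTX y.
- by move=> y; rewrite -{1}Ns; exact: ext_eq NXT y.
Qed.

End WeightedInverse.

Section RowFormula.
Context {R : realType} {A : cstarAlgType R} (H1 H2 H3 : hermModType A).
Variables (T : adjointable H1 H3) (B : adjointable H2 H3) (M : adjointable H3 H3).
Variables (N1 : adjointable H1 H1) (L : adjointable H2 H1) (N2 N3 : adjointable H2 H2).
Variables (Td : adjointable H3 H1) (Cd : adjointable H3 H2).
Let I1 := aid H1.
Let I2 := aid H2.
Let C := (aid H3 - T \oL Td) \oL B.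
Let D := Td \oL B.
Let S := N2 - adj L \oL (I1 - Td \oL T) \oL ainv N1 \oL L
           + adj D \oL N1 \oL D - adj D \oL L - adj L \oL D.
Let Q := I2 - Cd \oL C.
Let Rm := I2 + Q \oL ainv N3 \oL (S - N3).
Let V := ainv Rm \oL (Cd + Q \oL ainv N3 \oL (adj D \oL N1 - adj L) \oL Td).
Let J := D + (I1 - Td \oL T) \oL ainv N1 \oL L.
Let N := ablock N1 L (adj L) N2.

Hypotheses (Ms : adj M = M) (iM : invertible M).
Hypotheses (N1s : adj N1 = N1) (iN1 : invertible N1).
Hypothesis iN3 : invertible N3.
Hypotheses (wT : wMP_spec M N1 T Td) (wC : wMP_spec M N3 C Cd).

(* The projection onto the kernel of T along the range of Td, and its adjoint;
   N1 intertwines them. *)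
Let q1 (x : H1) : H1 := x - Td (T x).
Let q1' (x : H1) : H1 := x - adj T (adj Td x).

Lemma C_E x : C x = B x - T (Td (B x)). Proof. by []. Qed.
Lemma Q_E x : Q x = x - Cd (C x). Proof. by []. Qed.
Lemma adjQ_E x : adj Q x = x - adj C (adj Cd x). Proof. by []. Qed.
Lemma J_E x : J x = D x + q1 (ainv N1 (L x)). Proof. by []. Qed.
Lemma S_E x : S x = N2 x - adj L (q1 (ainv N1 (L x))) + adj D (N1 (D x))
  - adj D (L x) - adj L (D x).
Proof. by []. Qed.

Lemma Td_C0 x : Td (C x) = 0.
Proof. by rewrite C_E aB (wMP_XTX wT) subrr. Qed.

(** The range of [C] is [M]-orthogonal to that of [T]. *)
Lemma Cd_T0 x : Cd (T x) = 0.
Proof.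
have C'MT y : adj C (M (T y)) = 0.
  rewrite -[LHS]/(adj B (M (T y) - adj Td (adj T (M (T y))))).
  by rewrite (wMP_MTX wT) (wMP_TXT wT) subrr a0.
rewrite -(wMP_XTX wC); rewrite (_ : C (Cd (T x)) = 0) ?a0 //.
by rewrite -[LHS](ainvK iM) -(wMP_MTX wC) C'MT !a0.
Qed.

Lemma T_q1_0 x : T (q1 x) = 0.
Proof. by rewrite /q1 aB (wMP_TXT wT) subrr. Qed.

Lemma N1_q1 x : N1 (q1 x) = q1' (N1 x).
Proof. by rewrite /q1 /q1' aB (wMP_NXT wT). Qed.

Lemma q1_idem x : q1 (q1 x) = q1 x.
Proof. by rewrite {1}/q1 T_q1_0 a0 subr0. Qed.

Lemma q1_D0 x : q1 (D x) = 0.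
Proof. by rewrite /q1 /D /= (wMP_XTX wT) subrr. Qed.

Lemma adjD_q1'_0 x : adj D (q1' x) = 0.
Proof.
have aTdT y : adj Td (adj T (adj Td y)) = adj Td y.
  apply: ip_injl => z; rewrite -!aadjPr.
  by rewrite (wMP_XTX wT).
by rewrite -[LHS]/(adj B (adj Td (q1' x))) /q1' aB aTdT subrr a0.
Qed.

Lemma C_Q0 x : C (Q x) = 0.
Proof. by rewrite Q_E aB (wMP_TXT wC) subrr. Qed.

Lemma Q_Cd0 x : Q (Cd x) = 0.
Proof. by rewrite Q_E (wMP_XTX wC) subrr. Qed.

Lemma Q_idem x : Q (Q x) = Q x.
Proof. by rewrite Q_E C_Q0 a0 subr0. Qed.

Lemma Q_compl x : Q (x - Q x) = 0.
Proof. by rewrite aB Q_idem subrr. Qed.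

Lemma N3_Q x : N3 (Q x) = adj Q (N3 x).
Proof. by rewrite Q_E adjQ_E aB (wMP_NXT wC). Qed.

Lemma Q_N3V x : Q (ainv N3 x) = ainv N3 (adj Q x).
Proof. by rewrite -[x in RHS](ainvKV iN3) -N3_Q ainvK. Qed.

Lemma Rm_E x : Rm x = x - Q x + Q (ainv N3 (S x)).
Proof.
rewrite -[LHS]/(x + Q (ainv N3 (S x - N3 x))) aB aB ainvK //; zmod.
Qed.

(** [S] is the compression of [N] to the graph of [- J]. This is how positivity
    of [S] follows from that of [N]. *)
Definition graph : adjointable H2 (H1 * H2)%type := acol (- J) I2.

Lemma q1'_sub x y : q1' (x - y) = q1' x - q1' y.
Proof. by rewrite /q1' !aB; zmod. Qed.

Lemma q1'_N1D0 x : q1' (N1 (D x)) = 0.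
Proof. by rewrite -N1_q1 q1_D0 a0. Qed.

Lemma q1'_idem x : q1' (q1' x) = q1' x.
Proof. by rewrite -[x](ainvKV iN1) -!N1_q1 q1_idem. Qed.

Lemma q1'_compl0 x : q1' (x - q1' x) = 0.
Proof. by rewrite q1'_sub q1'_idem subrr. Qed.

Lemma N1_J x : N1 (J x) = N1 (D x) + q1' (L x).
Proof. by rewrite J_E aD N1_q1 ainvKV. Qed.

Lemma graph_compression : adj graph \oL N \oL graph = S.
Proof.
apply: adjointable_ext => x.
rewrite -[LHS]/(- adj J (N1 (- J x) + L x) + (adj L (- J x) + N2 x)).
have aJE y : adj J y = adj D y + adj L (ainv N1 (q1' y)).
  rewrite -[LHS]/(adj D y + adj L (adj (ainv N1) (q1' y))).
  by rewrite ainv_adj.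
have -> : N1 (- J x) + L x = L x - q1' (L x) - N1 (D x).
  by rewrite aN N1_J; zmod.
rewrite aJE q1'_sub q1'_compl0 q1'_N1D0 subr0 !a0 addr0 2!aB adjD_q1'_0.
by rewrite aN J_E aD S_E; zmod.
Qed.

(** For the decomposition given by [Q], [Rm] is block triangular with the
    identity as one diagonal block. Its block diagonal part [Th] is [N3^-1 Om],
    and [Rm = (1 + E) Th] with [E] of square zero. *)
Lemma Rm_invertible (Om : adjointable H2 H2) : invertible Om ->
  (forall x, Om x = N3 (x - Q x) - adj Q (N3 (x - Q x)) + adj Q (S (Q x))) ->
  invertible Rm.
Proof.
move=> iOm OmE.
pose Th := ainv N3 \oL Om; pose Th' := ainv Om \oL N3.
have ThE x : Th x = x - Q x + Q (ainv N3 (S (Q x))).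
  rewrite -[LHS]/(ainv N3 (Om x)) OmE aD aB ainvK // -!Q_N3V ainvK //.
  by rewrite Q_compl subr0.
pose E := Q \oL ainv N3 \oL S \oL (I2 - Q).
have EE x : E x = Q (ainv N3 (S (x - Q x))) by [].
have QE0 x : E x - Q (E x) = 0 by rewrite EE Q_idem subrr.
have E0 x : E (E x) = 0 by rewrite [LHS]EE QE0 !a0.
have ThQ x : Th x - Q (Th x) = x - Q x by rewrite ThE aD Q_compl add0r Q_idem addrK.
have ETh x : E (Th x) = E x by rewrite !EE ThQ.
have RmTh x : Rm x = Th x + E (Th x).
  rewrite ETh Rm_E ThE EE -[RHS]addrA; congr (_ + _).
  have -> : S x = S (Q x) + S (x - Q x) by rewrite -aD; congr (S _); zmod.
  by rewrite !aD.
have Th'K x : Th' (Th x) = x.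
  by rewrite -[LHS]/(ainv Om (N3 (ainv N3 (Om x)))) ainvKV // ainvK.
have ThK x : Th (Th' x) = x.
  by rewrite -[LHS]/(ainv N3 (Om (ainv Om (N3 x)))) ainvKV // ainvK.
exists (Th' \oL (I2 - E)); split; apply: adjointable_ext => x.
  rewrite -[LHS]/(Th' (Rm x - E (Rm x))) RmTh (aD E) E0.
  by rewrite -[RHS]Th'K; congr (Th' _); zmod.
rewrite -[LHS]/(Rm (Th' (x - E x))) RmTh ThK aB E0.
by rewrite -[RHS]/(x); zmod.
Qed.

Hypothesis iRm : invertible Rm.

Lemma RmV y : Rm (V y) =
  Cd y + Q (ainv N3 (adj D (N1 (Td y)) - adj L (Td y))).
Proof. by rewrite -[V y]/(ainv Rm _) ainvKV. Qed.

Lemma C_V y : C (V y) = C (Cd y).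
Proof.
have CRm x : C (Rm x) = C x by rewrite Rm_E aD aB !C_Q0 subr0 addr0.
by rewrite -CRm RmV aD C_Q0 addr0.
Qed.

Definition row_inverse : adjointable H3 (H1 * H2)%type := acol (Td - J \oL V) V.

Lemma row_inverseE y : row_inverse y = (Td y - J (V y), V y).
Proof. by []. Qed.

Lemma arow_inverse y : arow T B (row_inverse y) = T (Td y) + C (Cd y).
Proof.
rewrite -[LHS]/(T (Td y - J (V y)) + B (V y)) -C_V C_E aB J_E aD T_q1_0 addr0.
by rewrite -[D (V y)]/(Td (B (V y))); zmod.
Qed.

Lemma adjD_first_entry t : adj D (N1 (Td t - J (V t)) + L (V t))
   = adj D (N1 (Td t)) - adj D (N1 (D (V t))) + adj D (L (V t)).
Proof. by rewrite aD (aB N1) N1_J (aB (adj D)) (aD (adj D) (N1 _)) adjD_q1'_0 addr0. Qed.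

(** A vector of the kernel of the row is [(q1 v1 - D v2, v2)] with
    [Q v2 = v2]. Orthogonality to the first summand is the choice of [J],
    orthogonality to the second is the equation that defines [V]. *)
Lemma row_inverse_orthogonal t (v1 : H1) (v2 : H2) :
  T v1 + B v2 = 0 -> ip (N (row_inverse t)) (v1, v2) = 0 :> A.
Proof.
move=> Tv; have Cv : C v2 = 0.
  by rewrite C_E (_ : B v2 = - T v1) ?aN ?(wMP_TXT wT) ?subrr //;
     apply/eqP; rewrite -addr_eq0 addrC Tv.
have Qv : Q v2 = v2 by rewrite Q_E Cv a0 subr0.
have v1E : v1 = q1 v1 - D v2.
  rewrite /q1 (_ : D v2 = - Td (T v1)) ?opprK ?subrK //.
  rewrite -[D v2]/(Td (B v2)) -aN; congr (Td _).
  by apply/eqP; rewrite -addr_eq0 addrC Tv.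
set y := V t.
pose a := N1 (Td t - J y) + L y.
pose b := adj L (Td t - J y) + N2 y.
have q1'a : q1' a = 0.
  have -> : a = N1 (Td t) - N1 (D y) + (L y - q1' (L y)).
    by rewrite /a aB N1_J; zmod.
  have q1'_add (z w : H1) : q1' (z + w) = q1' z + q1' w.
    by rewrite /q1' !aD; zmod.
  by rewrite q1'_add q1'_compl0 q1'_sub q1'_N1D0 -N1_q1 /q1 (wMP_XTX wT) subrr a0 subr0 addr0.
have key : adj Q (b - adj D a) = 0.
  have -> : b - adj D a = S y - (adj D (N1 (Td t)) - adj L (Td t)).
    by rewrite /a adjD_first_entry -/y /b S_E aB J_E aD; zmod.
  rewrite -[LHS](ainvKV iN3) -Q_N3V aB aB.
  have : Q (Rm y) = Q (ainv N3 (adj D (N1 (Td t)) - adj L (Td t))).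
    by rewrite RmV aD Q_Cd0 add0r Q_idem.
  rewrite Rm_E aD aB !Q_idem subrr add0r => ->.
  by rewrite subrr a0.
rewrite -[ip _ _]/(ip a v1 + ip b v2).
rewrite {1}v1E ipBr.
have -> : ip a (q1 v1) = ip (q1' a) v1 :> A.
  by rewrite /q1 /q1' ipBr ipBl !aadjPr.
rewrite q1'a ip0l sub0r aadjPr addrC -ipBl -{1}Qv aadjPr key ip0l //.
Qed.

Lemma row_TXT u : arow T B (row_inverse (arow T B u)) = arow T B u.
Proof.
have CCdB x : C (Cd (B x)) = C x.
  rewrite -[RHS](wMP_TXT wC) [in RHS]C_E (aB Cd) Cd_T0 subr0 //.
rewrite arow_inverse -[arow T B u]/(T u.1 + B u.2) (aD Td) (aD T) (wMP_TXT wT).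
by rewrite (aD Cd) Cd_T0 add0r CCdB C_E; zmod.
Qed.

Lemma row_XTX y : row_inverse (arow T B (row_inverse y)) = row_inverse y.
Proof.
set z := arow T B _; have zE : z = T (Td y) + C (Cd y) := arow_inverse y.
have Tz : Td z = Td y by rewrite zE aD (wMP_XTX wT) Td_C0 addr0.
have Cz : Cd z = Cd y by rewrite zE aD Cd_T0 (wMP_XTX wC) add0r.
have Vz : V z = V y.
  rewrite -[LHS]/(ainv Rm (Cd z + Q (ainv N3 (adj D (N1 (Td z)) - adj L (Td z))))).
  by rewrite Tz Cz.
by rewrite !row_inverseE Tz Vz.
Qed.

Hypothesis Ns : adj N = N.

(** The fourth equation follows from [row_inverse_orthogonal]: [v - Y v] lies in
    the kernel of the row for [Y = X T], so [<N Y u, v> = <N Y u, Y v>], which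
    is hermitian in [u] and [v]. *)
Lemma is_wMP_row : is_wMP M N (arow T B) row_inverse.
Proof.
split.
- by apply: adjointable_ext => u; exact: row_TXT.
- by apply: adjointable_ext => y; exact: row_XTX.
- have -> : M \oL arow T B \oL row_inverse = M \oL T \oL Td + M \oL C \oL Cd.
    apply: adjointable_ext => y.
    by rewrite -[LHS]/(M (arow T B (row_inverse y))) arow_inverse aD.
  apply: adjointable_ext => y.
  rewrite -[LHS]/(adj Td (adj T (adj M y)) + adj Cd (adj C (adj M y))) Ms.
  by rewrite (wMP_MTX wT) (wMP_MTX wC).
pose Y := row_inverse \oL arow T B.
have NY u v : ip (N (Y u)) v = ip (N (Y u)) (Y v) :> A.
  apply/eqP; rewrite -subr_eq0 -ipBr; apply/eqP.
  have : arow T B (v - Y v) = 0 by rewrite aB row_TXT subrr.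
  by case: (v - Y v) => v1 v2; exact: row_inverse_orthogonal.
have -> : N \oL row_inverse \oL arow T B = N \oL Y by exact: adjointable_ext.
apply: adjointable_ext => u; apply: ip_injl => v.
rewrite -aadjPr -[(N \oL Y) v]/(N (Y v)) -[(N \oL Y) u]/(N (Y u)) NY.
by rewrite -[LHS]ip_star NY ip_star aadjPr Ns.
Qed.

End RowFormula.

Unset Implicit Arguments.
Set Strict Implicit.

Theorem theorem3p4 (R : realType) (alg : cstarAlgType R)
    (H1 H2 H3 : hilbertModType alg)
    (A : adjointable H1 H3) (B : adjointable H2 H3)
    (M : adjointable H3 H3)
    (N1 : adjointable H1 H1) (L : adjointable H2 H1) (N2 : adjointable H2 H2)
    (N3 : adjointable H2 H2) :
  let N := ablock N1 L (adj L) N2 in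
  let I1 := aid H1 in
  let I2 := aid H2 in
  let I3 := aid H3 in
  let Ad := wMP M N1 A in
  let C := (I3 - A \oL Ad) \oL B in
  let Cd := wMP M N3 C in
  let D := Ad \oL B in
  let S := N2 - adj L \oL (I1 - Ad \oL A) \oL ainv N1 \oL L
           + adj D \oL N1 \oL D - adj D \oL L - adj L \oL D in
  let Rm := I2 + (I2 - Cd \oL C) \oL ainv N3 \oL (S - N3) in
  let V := ainv Rm \oL
           (Cd + (I2 - Cd \oL C) \oL ainv N3 \oL (adj D \oL N1 - adj L) \oL Ad)
  in
  positive_definite M ->
  positive_definite N ->
  positive_definite N3 ->
  closed (range A) ->
  closed (range C) ->
  closed (range (arow A C)) ->
  [/\ invertible Rm,
      exists X, is_wMP M N (arow A B) X
    & wMP M N (arow A B)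
      = acol (Ad - (D + (I1 - Ad \oL A) \oL ainv N1 \oL L) \oL V) V].
Proof.
move=> N I1 I2 I3 Ad C Cd D S Rm V pM pN pN3 cA cC _.
have gM := positive_definite_gram pM; have gN3 := positive_definite_gram pN3.
have [[Z NZ] iN] := pN.
have gN : gram_definite N.
  split=> //; exists (H1 * H2)%type, Z.
  have p1 := @hilbert_ip_positive _ _ H1; have p2 := @hilbert_ip_positive _ _ H2.
  split=> //; first exact: prod_ip_positive.
  by apply: prod_bounded_domain => //; exact: hilbert_bounded_domain.
have gN1 : gram_definite N1.
  have -> : N1 = adj (ainl H1 H2) \oL N \oL ainl H1 H2.
    by apply: adjointable_ext => x /=; rewrite !a0 !addr0.
  apply: gram_definite_compression (adj (ainl H1 H2)) gN _.
  by apply: adjointable_ext => x /=; rewrite addr0.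
have wA : wMP_spec M N1 A Ad.
  apply: is_wMP_spec; rewrite ?gram_definite_adj //.
  exact/wMPP/wMP_exists.
have wC : wMP_spec M N3 C Cd.
  apply: is_wMP_spec; rewrite ?gram_definite_adj //.
  exact/wMPP/wMP_exists.
have [iM _] := gM; have [iN1 _] := gN1; have [iN3 _] := gN3.
have gS : gram_definite S.
  have -> : S = adj (graph A B N1 L Ad) \oL N \oL graph A B N1 L Ad.
    exact/esym/(graph_compression B L N2 (gram_definite_adj gN1) iN1 wA).
  apply: gram_definite_compression (adj (ainr H1 H2)) gN _.
  by apply: adjointable_ext => x /=; rewrite add0r.
(* The idempotent is Q, with weight S on its range and N3 on its kernel. *)
have [Om iOm OmE] := diagonal_invertible gS gN3 (Q_idem wC).
have iRm : invertible Rm.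
  apply: Rm_invertible iN3 wC _ iOm _ => x.
  by rewrite OmE addrC.
have wX := is_wMP_row (gram_definite_adj gM) iM iN1 iN3 wA wC iRm (gram_definite_adj gN).
have eX : exists X, is_wMP M N (arow A B) X := ex_intro _ _ wX.
split=> //; apply: is_wMP_uniq (wMPP eX) wX => //; exact: gram_definite_adj.
Qed.
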